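(* Let $d\ge 1$ be an integer. Given a graph $G$ on $n$ vertices with a weight function $w\colon V(G)\to\mathbb{R}$, together with a nice $k$-almost chordal tree decomposition of $G$ with $n^{\mathcal{O}(1)}$ bags, the \textsc{Weighted $d$-colorable Subgraph} problem can be solved in time $2^{\mathcal{O}(\sqrt{k}\cdot d\log d)}\cdot n^{\mathcal{O}(d)}$.
   Context: \textsc{Weighted $d$-colorable Subgraph}: given a graph $G$ with weight function $w\colon V(G)\to\mathbb{R}$, find a $d$-colorable induced subgraph $H$ of $G$ of maximum weight $\sum_{v\in V(H)}w(v)$. For a graph $H$, ${\sf c\mbox{-}comp}(H)$ is the number of non-adjacent pairs of distinct vertices of $H$. A tree decomposition of $G$ is a pair $(T,\{X_t\}_{t\in V(T)})$ where $T$ is a tree and $X_t\subseteq V(G)$ such that every vertex lies in some bag, every edge has both endpoints in some bag, and for each vertex the nodes whose bags contain it induce a connected subtree. It is $k$-almost chordal if ${\sf c\mbox{-}comp}(G[X_t])\le k$ for all $t$. It is nice if $T$ is rooted at $r$, $X_r=\emptyset$, leaves have empty bags, and every non-leaf node is an introduce node (one child $t'$, $X_t=X_{t'}\cup\{v\}$, $v\notin X_{t'}$), a forget node (one child $t'$, $X_t=X_{t'}\setminus\{w\}$, $w\in X_{t'}$), or a join node (two children with bags equal to $X_t$). *)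

(* Defs.v *)
From HB Require Import structures.
From mathcomp Require Import all_boot all_order all_algebra.
From mathcomp Require Import reals exp.

Set Implicit Arguments.
Unset Strict Implicit.
Unset Printing Implicit Defensive.

Import Order.TTheory GRing.Theory Num.Theory.

(** * Graphs and colourings *)

Definition simple_graph (V : finType) (e : rel V) : Prop :=
  symmetric e /\ irreflexive e.

(** Induced subgraphs are represented by their vertex sets. *)
Definition colorable (d : nat) (V : finType) (e : rel V) (S : {set V}) : Prop :=
  exists c : V -> 'I_d, {in S &, forall u v, e u v -> c u != c v}.

Definition weight (R : realType) (V : finType) (w : V -> R) (S : {set V}) : R :=
  (\sum_(v in S) w v)%R.

Definition max_weight_colorable (R : realType) (d : nat) (V : finType)
    (e : rel V) (w : V -> R) (S : {set V}) : Prop :=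
  colorable d e S /\
  forall S' : {set V}, colorable d e S' -> (weight w S' <= weight w S)%R.

(** Number of unordered pairs of distinct non-adjacent vertices of [G[X]]. *)
Definition c_comp (V : finType) (e : rel V) (X : {set V}) : nat :=
  #|[set [set u; v] | u in X, v in X & (u != v) && ~~ e u v]|.

(** * Tree decompositions *)

Definition is_tree (N : finType) (T : rel N) : Prop :=
  [/\ 0 < #|N|, simple_graph T, (forall s t, connect T s t) &
      forall p : seq N, 2 < size p -> uniq p -> ~~ cycle T p].

Definition induces_connected (N : finType) (T : rel N) (A : {set N}) : Prop :=
  {in A &, forall s t,
     connect [rel x y | [&& T x y, x \in A & y \in A]] s t}.

Definition tree_decomposition (V N : finType) (e : rel V) (T : rel N)
    (X : N -> {set V}) : Prop :=
  [/\ is_tree T,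
      (forall v, exists t, v \in X t),
      (forall u v, e u v -> exists t, (u \in X t) && (v \in X t)) &
      forall v, induces_connected T [set t | v \in X t]].

Definition almost_chordal (k : nat) (V N : finType) (e : rel V)
    (X : N -> {set V}) : Prop :=
  forall t, c_comp e (X t) <= k.

(** In the tree [T] rooted at [r], [u] is a child of [t] iff [u] is adjacent
    to [t] and removing [u] leaves [t] connected to [r], i.e. [t] is the last
    node before [u] on the path from [r] to [u]. *)
Definition child (N : finType) (T : rel N) (r t u : N) : bool :=
  T t u && connect [rel x y | [&& T x y, x != u & y != u]] t r.

Definition children (N : finType) (T : rel N) (r t : N) : {set N} :=
  [set u | child T r t u].

Definition leaf_node (V N : finType) (T : rel N) (r : N) (X : N -> {set V})
    (t : N) : Prop :=
  children T r t = set0 /\ X t = set0.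

Definition introduce_node (V N : finType) (T : rel N) (r : N)
    (X : N -> {set V}) (t : N) : Prop :=
  exists t' v, [/\ children T r t = [set t'], v \notin X t' & X t = v |: X t'].

Definition forget_node (V N : finType) (T : rel N) (r : N)
    (X : N -> {set V}) (t : N) : Prop :=
  exists t' v, [/\ children T r t = [set t'], v \in X t' & X t = X t' :\ v].

Definition join_node (V N : finType) (T : rel N) (r : N)
    (X : N -> {set V}) (t : N) : Prop :=
  exists t1 t2, [/\ t1 != t2, children T r t = [set t1; t2],
                    X t1 = X t & X t2 = X t].

Definition nice (V N : finType) (T : rel N) (r : N) (X : N -> {set V}) : Prop :=
  X r = set0 /\
  forall t, [\/ leaf_node T r X t, introduce_node T r X t,
                forget_node T r X t | join_node T r X t].

(** * A real RAM

    Memory consists of natural-number arrays and real arrays, both named by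
    literal numbers; scalar variables are cells of arrays.  The only arithmetic
    is addition and subtraction (truncated on naturals): with unit-cost
    multiplication on unbounded integers, time would no longer be polynomially
    related to Turing machine time.  Indices are computed (indirect addressing)
    and reals can only be moved, added, subtracted and compared; they cannot be
    converted to naturals. *)

Record state (R : realType) := State {
  nmem : nat -> nat -> nat;
  rmem : nat -> nat -> R
}.

Inductive nexp :=
  | NConst of nat
  | NGet of nat & nexp
  | NAdd of nexp & nexp
  | NSub of nexp & nexp.

Inductive rexp :=
  | RZero
  | RGet of nat & nexp
  | RAdd of rexp & rexp
  | RSub of rexp & rexp.

Inductive bexp :=
  | BLeN of nexp & nexp
  | BLeR of rexp & rexp
  | BNot of bexp
  | BAnd of bexp & bexp.

Inductive cmd :=
  | Skip
  | NSet of nat & nexp & nexp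
  | RSet of nat & nexp & rexp
  | Then of cmd & cmd
  | If of bexp & cmd & cmd
  | While of bexp & cmd.

Fixpoint neval (R : realType) (s : state R) (a : nexp) : nat :=
  match a with
  | NConst n => n
  | NGet x i => nmem s x (neval s i)
  | NAdd a1 a2 => neval s a1 + neval s a2
  | NSub a1 a2 => neval s a1 - neval s a2
  end.

Fixpoint reval (R : realType) (s : state R) (a : rexp) : R :=
  match a with
  | RZero => 0%R
  | RGet x i => rmem s x (neval s i)
  | RAdd a1 a2 => (reval s a1 + reval s a2)%R
  | RSub a1 a2 => (reval s a1 - reval s a2)%R
  end.

Fixpoint beval (R : realType) (s : state R) (b : bexp) : bool :=
  match b with
  | BLeN a1 a2 => neval s a1 <= neval s a2
  | BLeR a1 a2 => (reval s a1 <= reval s a2)%R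
  | BNot b1 => ~~ beval s b1
  | BAnd b1 b2 => beval s b1 && beval s b2
  end.

Definition upd (A : Type) (M : nat -> nat -> A) (x i : nat) (a : A) :
    nat -> nat -> A :=
  fun y j => if (y == x) && (j == i) then a else M y j.

Definition nset (R : realType) (s : state R) (x i a : nat) : state R :=
  State (upd (nmem s) x i a) (rmem s).

Definition rset (R : realType) (s : state R) (x i : nat) (a : R) : state R :=
  State (nmem s) (upd (rmem s) x i a).

(** [exec c s t s']: started in [s], the program [c] halts in [s'] after [t]
    steps.  Assignments and tests cost one step each; the size of the
    expressions in a fixed program is constant. *)
Inductive exec (R : realType) : cmd -> state R -> nat -> state R -> Prop :=
  | ExecSkip s : exec Skip s 1 s
  | ExecNSet x i a s :
      exec (NSet x i a) s 1 (nset s x (neval s i) (neval s a))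
  | ExecRSet x i a s :
      exec (RSet x i a) s 1 (rset s x (neval s i) (reval s a))
  | ExecThen c1 c2 s s1 s2 t1 t2 :
      exec c1 s t1 s1 -> exec c2 s1 t2 s2 -> exec (Then c1 c2) s (t1 + t2) s2
  | ExecIfTrue b c1 c2 s s' t :
      beval s b -> exec c1 s t s' -> exec (If b c1 c2) s t.+1 s'
  | ExecIfFalse b c1 c2 s s' t :
      ~~ beval s b -> exec c2 s t s' -> exec (If b c1 c2) s t.+1 s'
  | ExecWhileFalse b c s :
      ~~ beval s b -> exec (While b c) s 1 s
  | ExecWhileTrue b c s s1 s2 t1 t2 :
      beval s b -> exec c s t1 s1 -> exec (While b c) s1 t2 s2 ->
      exec (While b c) s (t1 + t2).+1 s2.

Lemma exec_det (R : realType) (c : cmd) (s s1 s2 : state R) (t1 t2 : nat) :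
  exec c s t1 s1 -> exec c s t2 s2 -> t1 = t2 /\ s1 = s2.
Proof.
move=> E1; elim: E1 t2 s2 => {c s t1 s1}; intros;
  match goal with E : exec _ _ _ _ |- _ => inversion E; subst => // end;
  repeat match goal with
  | b1 : is_true (beval ?s ?b), b2 : is_true (~~ beval ?s ?b) |- _ =>
      by rewrite b1 in b2
  | IH : (forall t' s', exec ?c ?s t' s' -> _), E : exec ?c ?s _ _ |- _ =>
      case: (IH _ _ E) => ? ?; subst; clear IH
  end; by [].
Qed.

(** * Input and output conventions *)

(** Row-major order. *)
Definition flatten_mx (p q : nat) (M : 'I_p -> 'I_q -> bool) : seq nat :=
  [seq nat_of_bool (M i j) | i <- enum 'I_p, j <- enum 'I_q].

(** Natural array 0 holds [n], [d], the number of nodes of the decomposition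
    and its root; arrays 1, 2 and 3 hold the adjacency matrix of the graph, the
    matrix of the child relation of the rooted tree and the incidence matrix of
    the bags.  Real array 0 holds the weights.  All other cells hold 0. *)
Definition input (R : realType) (n d m : nat) (e : rel 'I_n) (w : 'I_n -> R)
    (T : rel 'I_m) (r : 'I_m) (X : 'I_m -> {set 'I_n}) : state R :=
  State
    (fun x => nth 0 (nth [::]
       [:: [:: n; d; m; nat_of_ord r];
           flatten_mx e;
           flatten_mx (child T r);
           flatten_mx (fun t v => v \in X t)] x))
    (fun x => nth 0%R (nth [::] [:: [seq w v | v <- enum 'I_n]] x)).

Definition output (R : realType) (n : nat) (s : state R) : {set 'I_n} :=
  [set v : 'I_n | nmem s 4 v != 0].

(** * Running time *)

Definition log2 (R : realType) (x : R) : R := (ln x / ln 2)%R.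

(** [2 ^ O(sqrt k * d * log d) * n ^ O(d)] with hidden constant [C].  For
    [d = 1] the factor [log d] has to be read as a positive constant, hence
    [log2 (d + 1)]; and [n] is replaced by [max 2 n] so that the bound also
    makes sense for [n <= 1]. *)
Definition time_bound (R : realType) (C n d k : nat) : R :=
  (2 `^ (C%:R * (Num.sqrt k%:R * d%:R * log2 d.+1%:R)) *
   (maxn 2 n)%:R ^+ (C * d))%R.

(* Main.v *)
Require Import Defs.
From mathcomp Require Import all_boot all_order all_algebra.
From mathcomp Require Import reals.
From mathcomp Require Import exp zify.

Set Implicit Arguments.
Unset Strict Implicit.
Unset Printing Implicit Defensive.

Import Order.TTheory GRing.Theory Num.Theory.

(** If [G[X]] misses at most [k] edges then it has at most [(n + 1) 4^s]
    independent sets for [k < s^2], so that a bag has at most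
    [((n + 1) 4^s)^d] partial [d]-colourings, tuples of [d] independent sets.
    Dynamic programming over all pairs of a node and a partial colouring of
    its bag computes the optimum: a pair [(t, f)] is worth the sum over the
    children [u] of [t] of the best weight outside of the bag of [t] of a
    compatible pair [(u, g)], plus the worth of that pair.  Summing this
    recursion over all nodes telescopes, since every vertex enters a bag at
    exactly one node on the way down from the root; hence the root is worth
    the weight of an optimal solution.  Only values are computed: a solution
    is found by deleting every vertex without which the optimum stays the same.

    The running time is bounded by [a * B ^ b] with [a] the size of the program
    and [b] its loop depth, once every loop makes at most [B] iterations. *)

(** * A program logic with running times *)

(** The threshold [s] comes from a balance: at most [2k/s] vertices of a bag have [s] or more
    non-neighbours, and for [s] near [sqrt k] both this number and [s] are of order [sqrt k]. The
    cost bound is crude, but [a] and [b] are constants of one fixed program and the class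
    [2^O(sqrt k d) n^O(d)] is closed under constant powers; hence a single budget [B] may serve for
    vertices, colours, nodes and records alike. For this the list of records must stay free of
    duplicates and of invalid entries: colourings are built vertex by vertex in increasing order, so
    that each one has a unique predecessor, obtained by erasing its last vertex. One pass of
    deletions is enough because the optimum is monotone in the set of allowed vertices, so that a
    vertex once found indispensable remains so. *)

Fixpoint size_cmd (c : cmd) : nat :=
  match c with
  | Then c1 c2 => size_cmd c1 + size_cmd c2
  | If _ c1 c2 => (size_cmd c1 + size_cmd c2).+1
  | While _ c1 => (size_cmd c1).+2
  | _ => 1
  end.

Fixpoint loop_depth (c : cmd) : nat :=
  match c with
  | Then c1 c2 | If _ c1 c2 => maxn (loop_depth c1) (loop_depth c2)
  | While _ c1 => (loop_depth c1).+1
  | _ => 0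
  end.

Fixpoint nmods (c : cmd) : seq nat :=
  match c with
  | NSet x _ _ => [:: x]
  | Then c1 c2 | If _ c1 c2 => nmods c1 ++ nmods c2
  | While _ c1 => nmods c1
  | _ => [::]
  end.

Fixpoint rmods (c : cmd) : seq nat :=
  match c with
  | RSet x _ _ => [:: x]
  | Then c1 c2 | If _ c1 c2 => rmods c1 ++ rmods c2
  | While _ c1 => rmods c1
  | _ => [::]
  end.

Fixpoint nreads (a : nexp) : seq nat :=
  match a with
  | NConst _ => [::]
  | NGet x i => x :: nreads i
  | NAdd a1 a2 | NSub a1 a2 => nreads a1 ++ nreads a2
  end.

Definition For (x : nat) (a : nexp) (c : cmd) : cmd :=
  Then (NSet x (NConst 0) (NConst 0))
    (While (BNot (BLeN a (NGet x (NConst 0))))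
      (Then c (NSet x (NConst 0) (NAdd (NGet x (NConst 0)) (NConst 1))))).

Section Logic.
Variable R : realType.
Implicit Types (s : state R) (Q : state R -> Prop) (c : cmd).

(** The unit of framing is a whole array, so that [nmods] and [rmods] can be read off the syntax
    although indices are computed. *)
Definition agree (xs ys : seq nat) s s' : Prop :=
  (forall x i, x \notin xs -> nmem s' x i = nmem s x i) /\
  (forall y i, y \notin ys -> rmem s' y i = rmem s y i).

Lemma agree_trans xs ys s1 s2 s3 :
  agree xs ys s1 s2 -> agree xs ys s2 s3 -> agree xs ys s1 s3.
Proof.
move=> [n12 r12] [n23 r23]; split=> x i Hx; first by rewrite n23 ?n12.
by rewrite r23 ?r12.
Qed.

Lemma agree_sub xs ys xs' ys' s1 s2 :
  {subset xs <= xs'} -> {subset ys <= ys'} ->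
  agree xs ys s1 s2 -> agree xs' ys' s1 s2.
Proof.
move=> sx sy [n12 r12]; split=> x i Hx.
  by apply: n12; apply: contra Hx; apply: sx.
by apply: r12; apply: contra Hx; apply: sy.
Qed.

Lemma exec_agree c s t s' : exec c s t s' -> agree (nmods c) (rmods c) s s'.
Proof.
elim=> {c s t s'} //=.
- move=> x i a s; split=> // y j; rewrite inE /= /upd => /negPf -> //.
- move=> x i a s; split=> // y j; rewrite inE /= /upd => /negPf -> //.
- move=> c1 c2 s s1 s2 t1 t2 _ IH1 _ IH2; apply: (@agree_trans _ _ _ s1).
    by apply: agree_sub IH1 => x; rewrite mem_cat => ->.
  by apply: agree_sub IH2 => x; rewrite mem_cat orbC => ->.
- by move=> b c1 c2 s s' t _ _; apply: agree_sub => x; rewrite mem_cat => ->.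
- by move=> b c1 c2 s s' t _ _; apply: agree_sub => x; rewrite mem_cat orbC => ->.
- move=> b c s s1 s2 t1 t2 _ _ IH1 _ IH2; exact: agree_trans IH1 IH2.
Qed.

Lemma neval_agree xs ys s s' a :
  agree xs ys s s' -> all (fun x => x \notin xs) (nreads a) ->
  neval s' a = neval s a.
Proof.
move=> [H _]; elim: a => //= [x i IH /andP[Hx /IH ->]|a IHa b IHb|a IHa b IHb].
- exact: H.
- by rewrite all_cat => /andP[/IHa -> /IHb ->].
- by rewrite all_cat => /andP[/IHa -> /IHb ->].
Qed.

Variable B : nat.

(** Total correctness with a cost read off the syntax: each level of loop nesting costs a factor
    [B], and no invariant has to speak about time. *)
Definition run c s Q : Prop :=
  exists t s', [/\ exec c s t s', t <= size_cmd c * B ^ loop_depth c & Q s'].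

Hypothesis B_gt0 : 0 < B.

Lemma run_weaken c s Q Q' : (forall s', Q s' -> Q' s') -> run c s Q -> run c s Q'.
Proof. by move=> H [t [s' [E L /H]]]; exists t, s'. Qed.

(** Lets the proof of a postcondition use that all arrays never written are unchanged, so that
    invariants mention only what changes. *)
Lemma run_frame c s Q :
  run c s (fun s' => agree (nmods c) (rmods c) s s' -> Q s') -> run c s Q.
Proof. by case=> t [s' [E L H]]; exists t, s'; split=> //; apply/H/exec_agree/E. Qed.

Lemma run_skip s Q : Q s -> run Skip s Q.
Proof. by move=> H; exists 1, s; split=> //; constructor. Qed.

Lemma run_nset x i a s Q :
  Q (nset s x (neval s i) (neval s a)) -> run (NSet x i a) s Q.
Proof. by move=> H; exists 1; eexists; split; [constructor | rewrite expn0 | exact: H]. Qed.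

Lemma run_rset x i a s Q :
  Q (rset s x (neval s i) (reval s a)) -> run (RSet x i a) s Q.
Proof. by move=> H; exists 1; eexists; split; [constructor | rewrite expn0 | exact: H]. Qed.

Lemma leq_cost t a k k' : t <= a * B ^ k -> k <= k' -> t <= a * B ^ k'.
Proof. by move=> H K; apply: leq_trans H _; rewrite leq_mul2l leq_pexp2l ?orbT. Qed.

Lemma run_then c1 c2 s Q :
  run c1 s (fun s1 => run c2 s1 Q) -> run (Then c1 c2) s Q.
Proof.
case=> t1 [s1 [E1 L1 [t2 [s2 [E2 L2 H]]]]]; exists (t1 + t2), s2; split=> //.
  exact: ExecThen E1 E2.
rewrite /= mulnDl leq_add //.
  by apply: leq_cost L1 _; rewrite leq_maxl.
by apply: leq_cost L2 _; rewrite leq_maxr.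
Qed.

Lemma run_if b c1 c2 s Q :
  (beval s b -> run c1 s Q) -> (~~ beval s b -> run c2 s Q) ->
  run (If b c1 c2) s Q.
Proof.
move=> H1 H2.
have pos k : 1 <= B ^ k by rewrite expn_gt0 B_gt0.
case: (boolP (beval s b)) => Hb.
  have [t [s' [E L HQ]]] := H1 Hb; exists t.+1, s'; split=> //.
    exact: ExecIfTrue.
  rewrite /= mulSn -add1n leq_add // mulnDl; apply: leq_trans (leq_addr _ _).
  by apply: leq_cost L _; rewrite leq_maxl.
have [t [s' [E L HQ]]] := H2 Hb; exists t.+1, s'; split=> //.
  exact: ExecIfFalse.
rewrite /= mulSn -add1n leq_add // mulnDl; apply: leq_trans (leq_addl _ _).
by apply: leq_cost L _; rewrite leq_maxr.
Qed.

(** At most [B] rounds of a body of cost [a * K] cost at most [1 + B * (1 + a * K)], tests included.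
    This fits into [(a + 2) * (B * K)], whence the [.+2] in [size_cmd]. *)
Lemma run_while (I : nat -> state R -> Prop) J b c s Q :
  J <= B -> I 0 s ->
  (forall i s', i < J -> I i s' -> beval s' b /\ run c s' (I i.+1)) ->
  (forall s', I J s' -> ~~ beval s' b /\ Q s') ->
  run (While b c) s Q.
Proof.
move=> JB I0 step fin.
have pos k : 1 <= B ^ k by rewrite expn_gt0 B_gt0.
have key j i s' : i + j = J -> I i s' -> exists t s'',
    [/\ exec (While b c) s' t s'',
        t <= 1 + j * (1 + size_cmd c * B ^ loop_depth c) & Q s''].
  elim: j i s' => [|j IH] i s'.
    rewrite addn0 => -> /fin[Hb HQ]; exists 1, s'; split=> //.
    exact: ExecWhileFalse.
  rewrite addnS -addSn => ij Ii.
  have iJ : i < J by rewrite -ij ltnS leq_addr.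
  have [Hb [t1 [s1 [E1 L1 I1]]]] := step i s' iJ Ii.
  have [t2 [s2 [E2 L2 HQ]]] := IH _ _ ij I1.
  exists (t1 + t2).+1, s2; split=> //; first exact: ExecWhileTrue E1 E2.
  rewrite mulSn !add1n ltnS addSn -addnS leq_add //.
have [t [s' [E L HQ]]] := key J 0 s (add0n _) I0.
exists t, s'; split=> //; apply: leq_trans L _ => /=.
have := pos (loop_depth c); rewrite expnS.
move: (size_cmd c) (B ^ _) => a K K_gt0.
apply: (@leq_trans (1 + B * (1 + a * K))).
  by rewrite leq_add2l leq_mul2r JB orbT.
have : 1 <= B * K by rewrite muln_gt0 B_gt0.
have : B <= B * K by rewrite -{1}[B]muln1 leq_mul2l K_gt0 orbT.
have -> : a.+2 * (B * K) = B * (a * K) + (B * K + B * K).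
  by rewrite mulnCA !mulSn !mulnDr addnA addnC.
by rewrite mulnDr muln1; lia.
Qed.

(** The side condition protects the counter, and the arrays read by [a], from the body; hence [a]
    keeps its initial value although every test evaluates it again. *)
Lemma run_for (I : nat -> state R -> Prop) x a c s Q :
  (x \notin nmods c) && all (fun y => y \notin x :: nmods c) (nreads a) ->
  neval s a <= B -> I 0 (nset s x 0 0) ->
  (forall i s', i < neval s a -> nmem s' x 0 = i ->
     agree (x :: nmods c) (rmods c) s s' -> I i s' ->
     run c s' (fun s'' => I i.+1 (nset s'' x 0 i.+1))) ->
  (forall s', agree (x :: nmods c) (rmods c) s s' -> I (neval s a) s' -> Q s') ->
  run (For x a c) s Q.
Proof.
move=> /andP[xc ac] JB I0 step fin; apply/run_then/run_nset => /=.
pose I' i s' := [/\ nmem s' x 0 = i, agree (x :: nmods c) (rmods c) s s' & I i s'].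
have agx s1 i : agree (x :: nmods c) (rmods c) s1 (nset s1 x 0 i).
  by split=> // y j; rewrite inE negb_or /= /upd => /andP[/negPf -> _].
apply: (run_while (I := I') (J := neval s a)) => //=.
- by split=> //; rewrite /= /upd !eqxx.
- move=> i s' ia [xi ag Ii]; rewrite (neval_agree ag) // xi -ltnNge ia; split=> //.
  apply/run_then/run_frame; apply: run_weaken (step i s' ia xi ag Ii) => s1 I1 ag1.
  have x1 : nmem s1 x 0 = i by rewrite (proj1 ag1).
  apply: run_nset; rewrite /= x1 addn1; split=> //.
    by rewrite /= /upd !eqxx.
  apply: agree_trans (agx _ _); apply: agree_trans ag _.
  by apply: agree_sub ag1 => // y; rewrite inE orbC => ->.
- move=> s' [xi ag Ii]; rewrite (neval_agree ag) // xi leqnn; split=> //.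
  exact: fin.
Qed.

End Logic.

(** * Rooted trees *)

Section Tree.
Variables (N : finType) (T : rel N) (r : N).
Hypothesis treeT : is_tree T.

Let symT : symmetric T. Proof. by case: treeT => _ [] . Qed.
Let irrT : irreflexive T. Proof. by case: treeT => _ [] . Qed.

Definition avoid (u : N) : rel N := [rel x y | [&& T x y, x != u & y != u]].

Lemma avoid_path u x p :
  path (avoid u) x p = path T x p && ((p == [::]) || (u \notin x :: p)).
Proof.
elim: p x => [|y p IH] x //=; rewrite IH !inE !negb_or ![u == _]eq_sym.
have -> : avoid u x y = [&& T x y, x != u & y != u] by [].
case: (T x y); case: (x != u); case: (y != u); rewrite ?andbF ?andbT //=.
by case: p {IH} => [|z p]; rewrite ?andbT.
Qed.

Lemma tree_cycle x p : path T x p -> uniq (x :: p) -> 1 < size p ->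
  T (last x p) x -> False.
Proof.
move=> Tp Up sp Tx; case: treeT => _ _ _ /(_ (x :: p)).
by rewrite /= rcons_path Tp Tx => /(_ sp Up).
Qed.

Lemma child_root t : ~~ child T r t r.
Proof.
apply/negP => /andP[Ttr /connectP[p]]; rewrite avoid_path => /andP[Tp].
case: p Tp => [|x p] /= Tp.
  by move=> _ tr; rewrite tr irrT in Ttr.
by move=> /negP H E; apply: H; rewrite E inE mem_last orbT.
Qed.

Lemma child_path t u p : path T u (t :: p) -> uniq (u :: t :: p) ->
  last u (t :: p) = r -> child T r t u.
Proof.
move=> /= /andP[Tut Tp] /andP[utp _] E; rewrite /child symT Tut.
apply/connectP; exists p => //; by rewrite avoid_path Tp utp orbT.
Qed.

(** Two distinct parents of [u] would be joined by a path avoiding [u], which closes to a cycle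
    through [u]. *)
Lemma child_uniq t t' u : child T r t u -> child T r t' u -> t = t'.
Proof.
move=> /andP[Ttu c1] /andP[Ttu' c2].
have sym_av : connect_sym (avoid u).
  apply: sym_connect_sym => x y /=.
  by rewrite /avoid /= symT; case: (T y x) => //=; rewrite andbC.
have : connect (avoid u) t t'.
  by apply: connect_trans c1 _; rewrite sym_av.
case/connectP => p0 p0P E; case/shortenP: p0P E => p pP Up _ E.
have [p_nil|pn] := eqVneq p [::]; first by rewrite E p_nil.
move: pP; rewrite avoid_path (negPf pn) /= => /andP[Tp unp].
case: (@tree_cycle u (t :: p)) => //=.
- by rewrite symT Ttu.
- by rewrite unp.
- by case: (p) pn.
- by rewrite -E.
Qed.

Lemma parent_exists u : u != r -> exists t, child T r t u.
Proof.
move=> ur; have [_ _ /(_ u r)/connectP[p0 p0P E] _] := treeT.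
case/shortenP: p0P E => -[|t p] pP Up _ E; first by rewrite E eqxx in ur.
by exists t; apply: child_path pP Up (esym E).
Qed.

(* [r] is its own parent, a junk value. *)
Definition parent (u : N) : N := odflt r [pick t | child T r t u].

Lemma childE t u : child T r t u = (u != r) && (parent u == t).
Proof.
case: (u =P r) => [->|/eqP ur] /=; first exact/negbTE/child_root.
rewrite /parent; case: pickP => [t' ct'|no] /=.
  by apply/idP/eqP => [/(child_uniq ct')|<-].
by have [t' ] := parent_exists ur; rewrite no.
Qed.

(** Follow a simple path from [x] to the root: if it misses [y], then [x] is the parent of [y]; if
    [y] comes right after [x], then [y] is the parent of [x]; if [y] comes later, the edge closes a
    cycle. *)
Lemma adj_child x y : T x y -> child T r x y || child T r y x.
Proof.
move=> Txy; have [_ _ /(_ x r)/connectP[p0 p0P E] _] := treeT.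
case/shortenP: p0P E => p pP Up _ E.
have [yp|ynp] := boolP (y \in x :: p); last first.
  apply/orP; left; apply: (@child_path x y p) => //=.
  - by rewrite symT Txy.
  - by rewrite ynp.
have : y \in p.
  by move: yp; rewrite inE => /orP[/eqP E'|//]; rewrite E' irrT in Txy.
move=> {}yp; case/splitPr: yp pP Up E => p1 p2.
rewrite cat_path -cat_cons cat_uniq => /andP[P1 P2] Up E.
case: p1 P1 P2 Up E => [|z p1] P1 P2 Up E.
  apply/orP; right; apply: (@child_path y x p2 P2 _ (esym E)).
  by rewrite -cat1s cat_uniq.
case: (@tree_cycle x (rcons (z :: p1) y)).
- by rewrite rcons_path P1; case/andP: P2.
- case/and3P: Up => U1 /hasPn D _; rewrite -rcons_cons rcons_uniq U1 andbT.
  by apply: D; rewrite mem_head.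
- by rewrite size_rcons.
- by rewrite last_rcons symT.
Qed.

Lemma iter_parent_root u : exists2 i, i < #|N| & iter i parent u = r.
Proof.
have [_ _ /(_ u r)/connectP[p0 p0P E] _] := treeT.
case/shortenP: p0P E => p pP Up _ E; exists (size p).
  by have := card_uniqP Up => /= <-; exact: max_card.
elim: p u pP Up E => [|t p IH] u pP Up E //.
have ct := child_path pP Up (esym E).
rewrite iterSr; have -> : parent u = t.
  by move: ct; rewrite childE => /andP[_ /eqP].
by apply: IH; [case/andP: pP | case/andP: Up | ].
Qed.

Let ex_depth u : exists i, iter i parent u == r.
Proof. by have [i _ /eqP] := iter_parent_root u; exists i. Qed.

Definition depth u : nat := ex_minn (ex_depth u).

Lemma depth_lt u : depth u < #|N|.
Proof.
rewrite /depth; case: ex_minnP => i _ min_i.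
by have [j jN /eqP/min_i ij] := iter_parent_root u; apply: leq_ltn_trans jN.
Qed.

Lemma depth_root : depth r = 0.
Proof. by rewrite /depth; case: ex_minnP => i _ /(_ 0 (eqxx _)); case: i. Qed.

Lemma depth_parent u : u != r -> depth u = (depth (parent u)).+1.
Proof.
move=> ur; rewrite /depth.
case: ex_minnP => -[|i] Hi min_i; first by rewrite /= (negPf ur) in Hi.
case: ex_minnP => j Hj min_j; congr _.+1; apply/eqP.
rewrite eqn_leq min_j -?iterSr // andbT.
by rewrite -ltnS min_i // iterSr.
Qed.

Lemma depth_child t u : child T r t u -> depth u = (depth t).+1.
Proof. by rewrite childE => /andP[ur /eqP <-]; exact: depth_parent. Qed.

Section SumChildren.
Local Open Scope ring_scope.
Variable (R : zmodType).

Lemma sum_children (F : N -> N -> R) :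
  \sum_t \sum_(u | child T r t u) F t u = \sum_(u | u != r) F (parent u) u.
Proof.
rewrite [RHS](partition_big parent predT) //=; apply: eq_bigr => t _.
by apply: eq_big => u; rewrite childE // => /andP[_ /eqP ->].
Qed.

End SumChildren.

(** * Topmost bags, and families that agree along tree edges *)

Section Top.
Variables (V : finType) (X : N -> {set V}).
Hypotheses (Xr : X r = set0) (coverX : forall v, exists t, v \in X t).
Hypothesis connX : forall v, induces_connected T [set t | v \in X t].

Definition is_top v t := [&& t != r, v \in X t & v \notin X (parent t)].

Lemma top_exists v : exists t, is_top v t.
Proof.
have [t0 vt0] := coverX v.
case: (arg_minnP (P := fun t => v \in X t) depth vt0) => t vt min_t.
have tr : t != r by apply: contraTneq vt => ->; rewrite Xr inE.
exists t; rewrite /is_top tr vt /=; apply/negP => /min_t.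
by rewrite (depth_parent tr) ltnn.
Qed.

(** Walk from [t] to [t'] through bags containing [v]. A step up from [t] is impossible, so every
    node reached lies below [t] with [v] in all bags in between; as the parent of [t'] lacks [v],
    this forces [t' = t]. *)
Lemma top_uniq v t t' : is_top v t -> is_top v t' -> t = t'.
Proof.
move=> /and3P[tr vt vpt] /and3P[tr' vt' vpt'].
have in_v s0 : v \in X s0 -> s0 \in [set t | v \in X t] by rewrite inE.
have /connectP[p] := connX (in_v _ vt) (in_v _ vt').
pose P s := exists2 i, iter i parent s = t & forall j, j <= i -> v \in X (iter j parent s).
have P_t : P t by exists 0 => // j; rewrite leqn0 => /eqP ->.
suff walk q s : P s ->
    path [rel x y | [&& T x y, x \in [set t | v \in X t] & y \in [set t | v \in X t]]] s q ->
    P (last s q).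
  move=> /(walk _ _ P_t) + E; rewrite -E => -[[|i] //= <- /(_ 1 isT)].
  by rewrite /= (negPf vpt').
elim: q s => [|s' q IH] s Ps //=; rewrite !inE -!andbA => /and4P[Tss' vs vs'].
apply: IH; have /orP[] := adj_child Tss'; rewrite childE => /andP[_ /eqP E].
  have [i it Hi] := Ps; exists i.+1; first by rewrite iterSr E.
  by case=> [//|j] ji; rewrite iterSr E; apply: Hi.
have [[|i] it Hi] := Ps.
  by rewrite -it /= E vs' in vpt.
exists i; first by rewrite -E -iterSr.
by move=> j ji; rewrite -E -iterSr; apply: Hi.
Qed.

Lemma sum_top (R : zmodType) (F : V -> R) (P : pred V) :
  (\sum_(u | u != r) \sum_(v | [&& v \notin X (parent u), v \in X u & P v]) F v =
   \sum_(v | P v) F v)%R.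
Proof.
rewrite (exchange_big_dep P) /=; last by move=> u v _ /and3P[].
apply: eq_bigr => v Pv; have [t vt] := top_exists v.
rewrite (big_pred1 t) // => u; rewrite Pv andbT.
apply/idP/eqP => [H|->]; last by case/and3P: vt => -> -> ->.
apply: top_uniq vt; by case/and3P: H => *; apply/and3P.
Qed.

(** Agreement across single tree edges spreads over the connected set of bags containing [v]; this
    glues colourings of bags into one colouring of the graph. *)
Lemma family_const (C : eqType) (g : N -> V -> C) :
  (forall t u v, child T r t u -> v \in X t -> v \in X u -> g t v = g u v) ->
  forall v s t, v \in X s -> v \in X t -> g s v = g t v.
Proof.
move=> cg v s t vs vt.
have in_v s0 : v \in X s0 -> s0 \in [set t | v \in X t] by rewrite inE.
have /connectP[p] := connX (in_v _ vs) (in_v _ vt).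
move=> + ->; elim: p s {vs} => [|s' q IH] s //=.
rewrite !inE -!andbA => /and4P[Tss' vs vs' /IH <-].
by have /orP[] := adj_child Tss' => c; [|apply/esym]; apply: cg c _ _.
Qed.

End Top.
End Tree.

(** * The dynamic program *)

Section PartialColourings.
Variables (V N : finType) (d : nat) (e : rel V) (X : N -> {set V}) (A : {set V}).
Implicit Types (f g : {ffun V -> 'I_d.+1}) (S : {set V}).

(* Colour [0] means that the vertex is left out. *)
Definition supp (f : {ffun V -> 'I_d.+1}) : {set V} := [set v | f v != ord0].

Definition proper_col (f : {ffun V -> 'I_d.+1}) : bool :=
  [forall u, forall v, e u v && (f u != ord0) ==> (f u != f v)].

Definition valid (t : N) (f : {ffun V -> 'I_d.+1}) : bool :=
  (supp f \subset X t :&: A) && proper_col f.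

Definition mask (f : {ffun V -> 'I_d.+1}) (S : {set V}) : {ffun V -> 'I_d.+1} :=
  [ffun v => if v \in S then f v else ord0].

Definition compat (t u : N) (f g : {ffun V -> 'I_d.+1}) : bool :=
  [forall v, (v \in X t) && (v \in X u) ==> (f v == g v)].

Lemma proper_colP f :
  reflect (forall u v, e u v -> f u != ord0 -> f u != f v) (proper_col f).
Proof.
apply: (iffP forallP) => [H u v euv fu|H u].
  by have /forallP/(_ v) := H u; rewrite euv fu.
by apply/forallP => v; apply/implyP => /andP[]; apply: H.
Qed.

Lemma proper_mask f S : proper_col f -> proper_col (mask f S).
Proof.
move=> /proper_colP H; apply/proper_colP => u v euv; rewrite !ffunE.
by case: ifP => // _ fu; case: ifP => // _; apply: H.
Qed.

Lemma valid_mask f u S :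
  S \subset X u -> supp f \subset A -> proper_col f -> valid u (mask f S).
Proof.
move=> SX fA pf; rewrite /valid proper_mask // andbT.
apply/subsetP => v; rewrite !inE ffunE; case: ifP => [vS fv|]; last by rewrite eqxx.
by rewrite (subsetP SX) // (subsetP fA) // inE.
Qed.

Lemma valid0 t : valid t [ffun=> ord0].
Proof.
apply/andP; split; first by apply/subsetP => v; rewrite inE ffunE eqxx.
by apply/proper_colP => u v _; rewrite ffunE eqxx.
Qed.

Lemma valid_bag0 t f : X t = set0 -> valid t f -> f = [ffun=> ord0].
Proof.
move=> X0 /andP[/subsetP H _]; apply/ffunP => v; rewrite ffunE.
by apply/eqP/negPn/negP => fv; have := H v; rewrite !inE X0 inE => /(_ fv).
Qed.

Lemma colorable_supp f : proper_col f -> 0 < d -> colorable d e (supp f).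
Proof.
move=> /proper_colP H d_gt0; exists (fun v => insubd (Ordinal d_gt0) (f v).-1).
move=> u v; rewrite !inE => fu fv euv.
have := H _ _ euv fu; apply: contraNneq => /(congr1 val).
have lt (c : 'I_d.+1) : c.-1 < d by case: c => -[|c].
rewrite !val_insubd !lt => E; apply/eqP/val_inj.
by move: fu fv E; rewrite -!val_eqE /=; case: (f u : nat) (f v : nat) => [|a] [|b] //= _ _ ->.
Qed.

Lemma colorable_col S : colorable d e S -> exists2 f, proper_col f & supp f = S.
Proof.
case=> c cP; exists [ffun v => if v \in S then lift ord0 (c v) else ord0].
  apply/proper_colP => u v euv; rewrite !ffunE; case: ifP => // uS _.
  case: ifP => // vS; rewrite (inj_eq (@lift_inj _ _)); exact: cP.
by apply/setP => v; rewrite inE ffunE; case: ifP; rewrite ?eqxx.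
Qed.

End PartialColourings.

(** * The recursion and its value at the root *)

Section Recursion.
Variables (R : realType) (V N : finType) (d : nat) (e : rel V) (w : V -> R).
Variables (T : rel N) (r : N) (X : N -> {set V}) (A : {set V}).
Hypotheses (treeT : is_tree T) (Xr : X r = set0).
Local Open Scope ring_scope.
Local Notation col := {ffun V -> 'I_d.+1}.
Local Notation valid := (valid e X A).
Local Notation compat := (compat X).

Definition gain (t : N) (g : col) : R :=
  \sum_(v | (v \notin X t) && (g v != ord0)) w v.

(* The largest weight that an extension of [f] to the bags below [t] gains
   outside of the bag of [t]; the extension by no vertex at all gains [0]. *)
Fixpoint value_fuel (i : nat) (t : N) (f : col) : R :=
  if i is i'.+1 then
    \sum_(u | child T r t u)
      \big[Num.max/0]_(g | valid u g && compat t u f g)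
        (gain t g + value_fuel i' u g)
  else 0.

(** This fuel is always positive and drops by exactly one at each child, so that [valueE] holds
    without a side condition. *)
Definition value t := value_fuel (#|N| - depth r treeT t) t.

Lemma valueE t f : value t f =
  \sum_(u | child T r t u)
    \big[Num.max/0]_(g | valid u g && compat t u f g) (gain t g + value u g).
Proof.
rewrite /value; have := depth_lt r treeT t; rewrite -subn_gt0.
case E: (#|N| - depth r treeT t)%N => [|i] //= _.
apply: eq_bigr => u c; apply: eq_bigr => g _.
by rewrite (depth_child treeT c) subnS E.
Qed.

Lemma value_ge0 t f : 0 <= value t f.
Proof. by rewrite valueE sumr_ge0 // => u _; exact: bigmax_ge_id. Qed.

(** The default [0] of the maximum is attained or exceeded even for negative weights: the
    restriction of [f] to the common vertices of both bags is a competitor that gains nothing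
    outside of [X t] and has a nonnegative value. *)
Lemma best_exists t u f : valid t f -> exists g,
  [&& valid u g, compat t u f g &
   gain t g + value u g ==
   \big[Num.max/0]_(g | valid u g && compat t u f g) (gain t g + value u g)].
Proof.
move=> /andP[]; rewrite subsetI => /andP[fX fA] pf.
pose P g := valid u g && compat t u f g; pose F g := gain t g + value u g.
pose g0 := mask f (X t :&: X u).
have P0 : P g0.
  rewrite /P valid_mask ?subsetIr //=; apply/forallP => v; apply/implyP => H.
  by rewrite ffunE inE H.
have F0 : 0 <= F g0.
  rewrite addr_ge0 ?value_ge0 // /gain big1 // => v; rewrite ffunE inE.
  by case: (v \in X t) => //=; rewrite eqxx.
case: (Order.TotalTheory.arg_maxP (i0 := g0) (P := P) F P0) => g Pg maxg; exists g.
case/andP: (Pg) => -> -> /=; rewrite eq_le le_bigmax_cond //=.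
by apply: bigmax_le => //; exact: le_trans (maxg _ P0).
Qed.

Section Solutions.
Hypotheses (d_gt0 : (0 < d)%N) (decX : tree_decomposition e T X).

(** The restrictions of one colouring to all bags form a compatible family, so each maximum in the
    recursion is at least the term of this family. *)
Lemma value_ub (S : {set V}) : colorable d e S -> S \subset A ->
  weight w S <= value r [ffun=> ord0].
Proof.
have [_ cov _ con] := decX.
move=> /colorable_col[h ph <-] hA; pose f t := mask h (X t).
have vf t : valid t (f t) by rewrite valid_mask.
have <- : f r = [ffun=> ord0] by apply: valid_bag0 Xr (vf r).
have le_t t : \sum_(u | child T r t u) (gain t (f u) + value u (f u)) <= value t (f t).
  rewrite [leRHS]valueE; apply: ler_sum => u _.
  apply: (le_bigmax_cond _ (fun g => gain t g + value u g)).
  rewrite vf; apply/forallP => v; apply/implyP => /andP[vt vu].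
  by rewrite !ffunE vt vu.
have : \sum_t \sum_(u | child T r t u) (gain t (f u) + value u (f u)) <=
       \sum_t value t (f t) by apply: ler_sum => t _; exact: le_t.
rewrite (sum_children r treeT (fun t u => gain t (f u) + value u (f u))).
rewrite [X in _ <= X](bigD1 r) //= big_split /= lerD2r; congr (_ <= _).
rewrite /weight -(sum_top treeT Xr cov con).
apply: eq_bigr => u _; apply: eq_big => // v.
rewrite ffunE inE; case: (v \in X u); rewrite ?eqxx //= ?andbF //.
Qed.

(** Maximisers are chosen from the root downwards, each for the colouring already fixed at the
    parent. Compatibility glues them into one colouring [h], proper because every edge lies in a
    bag. *)
Lemma value_attained : exists S : {set V},
  [/\ S \subset A, colorable d e S & weight w S = value r [ffun=> ord0]].
Proof.
have [_ cov edg con] := decX.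
pose best t u f : col := odflt [ffun=> ord0] [pick g |
  [&& valid u g, compat t u f g & gain t g + value u g ==
   \big[Num.max/0]_(g | valid u g && compat t u f g) (gain t g + value u g)]].
have bestP t u f : valid t f -> [&& valid u (best t u f), compat t u f (best t u f)
  & gain t (best t u f) + value u (best t u f) ==
   \big[Num.max/0]_(g | valid u g && compat t u f g) (gain t g + value u g)].
  move=> vf; rewrite /best; case: pickP => // no.
  by have [g] := best_exists u vf; rewrite no.
(* [G i s] is meaningful only if [s] has depth [i]. *)
pose G := fix G i s := if i is i'.+1 then best (parent T r s) s (G i' (parent T r s))
  else [ffun=> ord0].
pose g s := G (depth r treeT s) s.
have g_r : g r = [ffun=> ord0] by rewrite /g depth_root.
have g_child t u : child T r t u -> g u = best t u (g t).
  move=> c; rewrite /g (depth_child treeT c) /=.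
  by move: c; rewrite (childE _ treeT) => /andP[_ /eqP ->].
have vg t : valid t (g t).
  move E: (depth r treeT t) => i; elim: i t E => [|i IH] t E.
    by rewrite /g E /=; exact: valid0.
  have tr : t != r by apply: contra_eq_neq E => ->; rewrite depth_root.
  have c : child T r (parent T r t) t by rewrite (childE _ treeT) tr eqxx.
  rewrite (g_child _ _ c); have := bestP _ t _ (IH (parent T r t) _).
  by case/(_ _)/and3P => //; move: E; rewrite (depth_child treeT c) => -[].
have gtu t u : child T r t u -> compat t u (g t) (g u).
  by move=> c; rewrite (g_child _ _ c); case/and3P: (bestP _ u _ (vg t)).
have val_g : value r (g r) = \sum_(u | u != r) gain (parent T r u) (g u).
  have : \sum_t value t (g t) =
         \sum_t \sum_(u | child T r t u) (gain t (g u) + value u (g u)).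
    apply: eq_bigr => t _; rewrite valueE; apply: eq_bigr => u c.
    by rewrite (g_child _ _ c); case/and3P: (bestP _ u _ (vg t)) => _ _ /eqP ->.
  rewrite (sum_children r treeT (fun t u => gain t (g u) + value u (g u))).
  by rewrite (bigD1 r) //= big_split /= => /addIr.
(* Any bag containing [v] gives the same colour, by [family_const]. *)
pose bag v := xchoose (cov v).
have bagP v : v \in X (bag v) by exact: xchooseP (cov v).
pose h : col := [ffun v => g (bag v) v].
have gh t v : v \in X t -> g t v = h v.
  move=> vt; rewrite ffunE.
  apply: (family_const treeT con (r := r) (g := g)) => // t1 t2 x c x1 x2.
  by have /forallP/(_ x) := gtu _ _ c; rewrite x1 x2 => /eqP.
have ph : proper_col e h.
  apply/proper_colP => u v euv; have [t /andP[ut vt]] := edg u v euv.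
  rewrite -!(gh t) //; have /andP[_ /proper_colP] := vg t; exact.
exists (supp h); split.
- apply/subsetP => v; rewrite inE ffunE => hv.
  have /andP[/subsetP/(_ v)] := vg (bag v); rewrite !inE => /(_ hv)/andP[] //.
- exact: colorable_supp.
- rewrite -g_r val_g /weight -(sum_top treeT Xr cov con); apply: eq_bigr => u _.
  apply: eq_bigl => v; rewrite !inE; congr (_ && _).
  have [vu|vu] := boolP (v \in X u); first by rewrite gh.
  have /andP[/subsetP/(_ v)] := vg u; rewrite !inE (negPf vu) /=.
  by case: (g u v != ord0) => // /(_ isT).
Qed.

End Solutions.
End Recursion.

(** * Counting partial colourings of a bag *)

Section Counting.
Variables (V : finType) (e : rel V).
Implicit Types (Y : {set V}).

Definition non_nbrs (Y : {set V}) (v : V) : {set V} :=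
  [set u in Y | (u != v) && ~~ e v u].

Definition independents (Y : {set V}) : {set {set V}} :=
  [set S : {set V} | (S \subset Y) && [forall u in S, forall v in S, ~~ e u v]].

(** The sum counts ordered non-adjacent pairs, and forgetting the order has fibres of size at most
    two. *)
Lemma sum_non_nbrs Y : \sum_(v in Y) #|non_nbrs Y v| <= (c_comp e Y).*2.
Proof.
pose P := [set p : V * V | [&& p.1 \in Y, p.2 \in Y, p.1 != p.2 & ~~ e p.1 p.2]].
pose phi (p : V * V) := [set p.1; p.2].
have -> : \sum_(v in Y) #|non_nbrs Y v| = #|P|.
  under eq_bigr do rewrite -sum1_card.
  rewrite -sum1_card pair_big_dep; apply: eq_bigl => -[u v].
  by rewrite !inE /= [v == u]eq_sym.
rewrite -sum1_card (partition_big_imset phi) /= -muln2.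
apply: (@leq_trans (#|phi @: P| * 2)).
  rewrite -sum_nat_const leq_sum // => S /imsetP[[u v] _ ->].
  rewrite sum1_card; apply: leq_trans (_ : #|[set (u, v); (v, u)]| <= 2); last first.
    by rewrite cards2 ltnS leq_b1.
  apply/subset_leq_card/subsetP => -[x y]; rewrite unfold_in !inE /=.
  move=> /andP[/and4P[_ _ xy _] /eqP E].
  have : x \in phi (u, v) by rewrite -E !inE eqxx.
  have : y \in phi (u, v) by rewrite -E !inE eqxx orbT.
  rewrite !inE /= -!pair_eqE /pair_eq /= => /orP[]/eqP Ey /orP[]/eqP Ex;
    by rewrite Ex Ey ?eqxx ?orbT // in xy *.
rewrite leq_mul2r; apply/subset_leq_card/subsetP => _ /imsetP[[u v] + ->].
rewrite inE /= => /and4P[uY vY uv euv]; apply/imset2P.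
by exists u v => //; rewrite !inE vY uv.
Qed.

(* An independent set inside [Y] either consists of vertices with at least [s]
   non-neighbours, of which there are few, or lies in the closed
   non-neighbourhood of a vertex with fewer than [s] of them. *)
Lemma card_independents Y k s : c_comp e Y <= k -> k < s * s ->
  #|independents Y| <= #|V|.+1 * 4 ^ s.
Proof.
move=> Yk ks; pose high := [set v in Y | s <= #|non_nbrs Y v|].
have s_gt0 : 0 < s by rewrite lt0n; apply: contraTneq ks => ->.
(* Each vertex of [high] contributes at least [s] to a sum that is at most [2k], and [k < s * s]. *)
have card_high : #|high| <= s.*2.
  rewrite -(leq_pmul2r s_gt0); apply: (@leq_trans k.*2); last first.
    by rewrite -doubleMl leq_double ltnW.
  apply: leq_trans (_ : (c_comp e Y).*2 <= _); last by rewrite leq_double.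
  apply: leq_trans (sum_non_nbrs Y).
  rewrite -sum_nat_const [leqRHS](big_setID high) /=.
  apply: leq_trans (leq_addr _ _); rewrite (setIidPr _); last first.
    by apply/subsetP => v; rewrite inE => /andP[].
  by apply: leq_sum => v; rewrite inE => /andP[].
pose low v := [set v |: S | S in powerset (non_nbrs Y v)].
(* There are at most [2 ^ (2 * s) = 4 ^ s] subsets of [high], and at most [2 ^ s <= 4 ^ s] sets for
   each of the at most [#|V|] other vertices; this is the factor [#|V|.+1]. *)
have sub : independents Y \subset
    powerset high :|: \bigcup_(v in Y :\: high) low v.
  apply/subsetP => S; rewrite inE => /andP[SY /forall_inP indS].
  rewrite in_setU powersetE; have [//|/subsetPn[v vS vh]] := boolP (S \subset high).
  apply/orP; right; apply/bigcupP; exists v; first by rewrite inE vh (subsetP SY).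
  apply/imsetP; exists (S :\ v); last by rewrite setD1K.
  rewrite powersetE; apply/subsetP => u; rewrite !inE => /andP[uv uS].
  by rewrite (subsetP SY) // uv; have /forall_inP -> := indS v vS.
have E4 : 4 ^ s = 2 ^ s.*2 by rewrite -mul2n expnM.
have low_card v : v \in Y :\: high -> #|low v| <= 4 ^ s.
  rewrite !inE => /andP[+ vY]; rewrite vY /= -ltnNge => lt.
  apply: leq_trans (leq_imset_card _ _) _; rewrite card_powerset E4.
  by rewrite leq_exp2l // -addnn (leq_trans (ltnW lt)) ?leq_addr.
apply: leq_trans (subset_leq_card sub) _.
apply: leq_trans (leq_card_setU _ _) _; rewrite mulSn leq_add //.
  by rewrite card_powerset E4 leq_exp2l.
have bound (D : {set V}) : (forall v, v \in D -> #|low v| <= 4 ^ s) ->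
    #|\bigcup_(v in D) low v| <= #|D| * 4 ^ s.
  move=> H; rewrite -sum_nat_const.
  apply: leq_trans (_ : \sum_(v in D) #|low v| <= _); last exact: leq_sum.
  apply: (big_ind2 (fun (S : {set {set V}}) j => #|S| <= j)); rewrite ?cards0 //.
  move=> S1 i1 S2 i2 H1 H2; apply: leq_trans (leq_card_setU _ _) _.
  exact: leq_add.
by apply: leq_trans (bound _ low_card) _; rewrite leq_mul2r max_card orbT.
Qed.

Lemma card_valid (N : finType) (d k s : nat) (X : N -> {set V}) (A : {set V}) t :
  c_comp e (X t) <= k -> k < s * s ->
  #|[set f : {ffun V -> 'I_d.+1} | valid e X A t f]| <= (#|V|.+1 * 4 ^ s) ^ d.
Proof.
move=> Xk ks.
pose cls (f : {ffun V -> 'I_d.+1}) : {ffun 'I_d -> {set V}} :=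
  [ffun i => [set v | f v == lift ord0 i]].
(* The vertices of colour [0] are those in no class, so the [d] classes determine [f]. *)
have cls_inj : injective cls.
  move=> f g /ffunP E; apply/ffunP => v.
  have {}E i : (f v == lift ord0 i) = (g v == lift ord0 i).
    by have := E i; rewrite !ffunE => /setP/(_ v); rewrite !inE.
  case: (unliftP ord0 (f v)) => [i fv|fv].
    by have := E i; rewrite fv eqxx => /esym/eqP ->.
  case: (unliftP ord0 (g v)) => [i gv|->//].
  by have := E i; rewrite gv eqxx => /eqP.
rewrite -(card_imset _ cls_inj).
apply: (@leq_trans (#|independents (X t)| ^ d)); last first.
  by case: d {cls cls_inj} => // d; rewrite leq_exp2r // (card_independents Xk).
rewrite -[X in _ ^ X](card_ord d) -card_ffun_on.
apply/subset_leq_card/subsetP => _ /imsetP[f + ->].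
rewrite inE => /andP[/subsetP fX /proper_colP pf]; apply/ffun_onP => i.
have nz v : f v == lift ord0 i -> f v != ord0.
  by move=> /eqP ->; rewrite eq_sym neq_lift.
rewrite ffunE inE; apply/andP; split.
  by apply/subsetP => v; rewrite inE => /nz fv; have := fX v; rewrite !inE => /(_ fv)/andP[].
apply/forall_inP => u; rewrite inE => fu; apply/forall_inP => v; rewrite inE => fv.
apply/negP => /pf/(_ (nz _ fu)).
by rewrite (eqP fu) (eqP fv) eqxx.
Qed.

End Counting.

(** * The iteration budget and its comparison with the time bound *)

Lemma leq_exp_base a b c : a <= b -> a ^ c <= b ^ c.
Proof. by case: c => // c ab; rewrite leq_exp2r. Qed.

(** The upper bound makes [q.+1] a threshold for counting independent sets; the lower one gives
    [q <= sqrt k] in the running time. *)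
Lemma sqrt_floor k : exists q, q * q <= k < q.+1 * q.+1.
Proof.
elim: k => [|k [q /andP[qk kq]]]; first by exists 0.
have [H|H] := ltnP k.+1 (q.+1 * q.+1); first by exists q; rewrite H ltnW.
by exists q.+1; rewrite H (leq_ltn_trans kq) // ltn_mul.
Qed.

Section Budget.
Variables (c n d q : nat).
Hypothesis d_gt0 : 0 < d.

(** With [N = maxn 2 n], there are at most [N ^ c] bags, each with at most
    [((n + 1) * 4 ^ (q + 1)) ^ d] partial colourings, and [n + 1 <= N ^ 2]. *)
Definition budget : nat := maxn 2 n ^ (c + 2 * d) * 4 ^ (q.+1 * d).

Let n2 : 2 <= maxn 2 n. Proof. exact: leq_maxl. Qed.
Let n1 : 0 < maxn 2 n. Proof. exact: ltnW. Qed.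

Lemma leq_budget a : a <= maxn 2 n ^ (c + 2 * d) -> a <= budget.
Proof. by move/leq_trans; apply; rewrite leq_pmulr // expn_gt0. Qed.

Lemma budget_gt0 : 0 < budget.
Proof. by apply: leq_budget; rewrite expn_gt0 n1. Qed.

Lemma budget_n : n <= budget.
Proof.
apply: leq_budget; apply: leq_trans (leq_maxr 2 n) _.
by rewrite -{1}[maxn 2 n]expn1 leq_exp2l // addn_gt0 muln_gt0 d_gt0 orbT.
Qed.

Lemma budget_d : d <= budget.
Proof.
apply: leq_budget; apply: leq_trans (ltnW (ltn_expl d (isT : 1 < 2))) _.
apply: leq_trans (leq_exp_base d n2) _.
by rewrite leq_exp2l // mul2n -addnn addnA leq_addl.
Qed.

Lemma budget_m m : m <= maxn 2 n ^ c -> m <= budget.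
Proof.
by move=> mn; apply: leq_budget; apply: leq_trans mn _; rewrite leq_exp2l ?leq_addr.
Qed.

Lemma budget_records m : m <= maxn 2 n ^ c ->
  m * (n.+1 * 4 ^ q.+1) ^ d <= budget.
Proof.
move=> mn; rewrite /budget expnD -mulnA expnMn !expnM leq_mul //.
rewrite leq_mul //; apply: leq_exp_base.
have : n <= maxn 2 n by exact: leq_maxr.
move: n2; move: (maxn 2 n) => N N2 nN; rewrite expnS expn1.
by apply: (@leq_trans (N * 2)); [rewrite muln2 -addnn; lia | rewrite leq_mul2l N2 orbT].
Qed.

(** With [N = maxn 2 n], the factors [K <= N ^ K] and [4 ^ (d * D) <= N ^ (2 * d * D)] join
    [N ^ ((c + 2 * d) * D)]; the total exponent [K + (c + 4 * d) * D] is at most [C * d]. Only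
    [4 ^ (q * d * D)] is left for the factor with [sqrt k]. *)
Lemma budget_time (R : realType) (k K D t C : nat) : q * q <= k ->
  t <= K * budget ^ D -> K + (c + 4) * D <= C -> (t%:R <= time_bound R C n d k)%R.
Proof.
move=> qk tK KC.
have le_t : t <= 2 ^ (2 * D * q * d) * maxn 2 n ^ (C * d).
  apply: leq_trans tK _.
  apply: leq_trans (leq_mul (ltnW (ltn_expl K (isT : 1 < 2))) (leqnn _)) _.
  rewrite /budget expnMn -!expnM -(expnM 2 2).
  have -> : 2 * (q.+1 * d * D) = 2 * D * q * d + 2 * d * D by lia.
  rewrite expnD mulnA [in leqLHS]mulnCA leq_mul //.
  apply: leq_trans (leq_mul (leq_mul (leq_exp_base K n2) (leqnn _)) (leq_exp_base _ n2)) _.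
  rewrite -!expnD leq_exp2l //.
  apply: leq_trans (leq_mul KC (leqnn d)).
  have : c * D <= c * D * d by rewrite leq_pmulr.
  have : K <= K * d by rewrite leq_pmulr.
  lia.
rewrite /time_bound -natrX.
apply: (@le_trans _ _ ((2 ^ (2 * D * q * d) * maxn 2 n ^ (C * d))%:R)%R).
  by rewrite ler_nat.
rewrite natrM ler_wpM2r ?ler0n // natrX -powR_mulrn ?ler0n //.
rewrite ler_powR ?ler1n //.
have DC : 2 * D <= C by apply: leq_trans KC; lia.
have qs : ((q%:R : R) <= Num.sqrt k%:R)%R.
  rewrite -(ler_sqr (x := q%:R)%R) ?nnegrE ?sqrtr_ge0 ?ler0n //.
  by rewrite sqr_sqrtr ?ler0n // -natrX ler_nat expnS expn1.
(* As [d >= 1], the logarithm is at least [1] and may be inserted as a factor of the exponent. *)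
have lg : (1 <= @log2 R d.+1%:R)%R.
  have l2 : (0 < ln (2 : R))%R by rewrite ln_gt0 // ltr1n.
  by rewrite /log2 ler_pdivlMr // mul1r ler_ln ?posrE ?ltr0n // ler_nat ltnS.
rewrite -mulnA natrM; apply: ler_pM; rewrite ?ler0n ?ler_nat //.
rewrite natrM -[leLHS]mulr1; apply: ler_pM; rewrite ?mulr_ge0 ?ler0n //.
by apply: ler_pM; rewrite ?ler0n.
Qed.

End Budget.

(** * Enumerating partial colourings *)

Section Enumeration.
Variables (n d m : nat) (e : rel 'I_n) (X : 'I_m -> {set 'I_n}) (A : {set 'I_n}).
Hypothesis simple_e : simple_graph e.
Local Notation col := {ffun 'I_n -> 'I_d.+1}.
Local Notation record := ('I_m * col)%type.
Local Notation valid := (valid e X A).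
Implicit Types (L E : seq record) (x y : record) (f : col) (c : 'I_d).

Lemma lift0E c : lift ord0 c = c.+1 :> nat.
Proof. by rewrite lift0. Qed.

Lemma ord_leq0 (a : 'I_d.+1) : (a <= 0) = (a == ord0).
Proof. by rewrite leqn0 -val_eqE. Qed.

Definition below f (v : nat) : bool := [forall u, (f u != ord0) ==> (u < v)].

Lemma belowP f v : reflect (forall u : 'I_n, f u != ord0 -> u < v) (below f v).
Proof. by apply: (iffP forallP) => H u; [move/(implyP (H u)) | apply/implyP/H]. Qed.

Definition recolour f (v : 'I_n) (a : 'I_d.+1) : col :=
  [ffun u => if u == v then a else f u].

Lemma recolourK f v a : recolour (recolour f v a) v (f v) = f.
Proof. by apply/ffunP => u; rewrite !ffunE; case: eqP => [->|]. Qed.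

Definition extendable x (t : 'I_m) (v : 'I_n) c : bool :=
  [&& x.1 == t, v \in X t, v \in A &
      [forall u, ~~ (e v u && (x.2 u == lift ord0 c))]].

Lemma valid_uncolour t f v : valid t f -> valid t (recolour f v ord0).
Proof.
move=> /andP[/subsetP H /proper_colP pf]; apply/andP; split.
  apply/subsetP => u; rewrite inE ffunE; case: (u =P v) => [|_ fu]; first by rewrite eqxx.
  by apply: H; rewrite inE.
apply/proper_colP => u1 u2 euv; rewrite !ffunE; case: (u1 =P v) => [|_ fu].
  by rewrite eqxx.
by case: (u2 =P v) => // _; apply: pf.
Qed.

(** Since [f] is proper, only edges at [v] can become conflicts, and irreflexivity excludes a loop
    at [v]. Hence one pass over the vertices decides validity. *)
Lemma valid_recolour t f v c : f v = ord0 -> valid t f ->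
  extendable (t, f) t v c = valid t (recolour f v (lift ord0 c)).
Proof.
have [sym irr] := simple_e.
move=> fv /andP[/subsetP H /proper_colP pf]; rewrite /extendable eqxx /=.
apply/and3P/andP => [[vX vA /forallP nb]|[/subsetP sub /proper_colP pg]].
  split.
    apply/subsetP => u; rewrite inE ffunE; case: (u =P v) => [->|_ fu].
      by rewrite inE vX.
    by apply: H; rewrite inE.
  apply/proper_colP => u1 u2 euv; rewrite !ffunE.
  case: (u1 =P v) => [E1|_]; case: (u2 =P v) => [E2|_].
  - by move: euv; rewrite E1 E2 irr.
  - by move=> _; have := nb u2; rewrite -E1 euv eq_sym.
  - by move=> _; have := nb u1; rewrite sym -E2 euv.
  - exact: pf.
have lt0 : lift ord0 c != ord0 by rewrite eq_sym neq_lift.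
have /setIP[-> ->] : v \in X t :&: A by apply: sub; rewrite inE ffunE eqxx.
split=> //; apply/forallP => u; apply/negP => /andP[evu /eqP fu].
have := pg _ _ evu; rewrite !ffunE eqxx => /(_ lt0).
by case: (u =P v) => [E|_]; [move: evu; rewrite E irr | rewrite fu eqxx].
Qed.

(** The exact description serves twice: membership turns maxima over the list into maxima over all
    valid colourings, and uniqueness keeps the list within the budget. *)
Definition nodes_done (t : nat) L : Prop :=
  uniq L /\ forall x, (x \in L) = valid x.1 x.2 && (x.1 < t).

Definition vertices_done (t v : nat) L : Prop :=
  uniq L /\ forall x, (x \in L) =
    valid x.1 x.2 && ((x.1 < t) || (x.1 == t :> nat) && below x.2 v).

Lemma nodes_done0 : nodes_done 0 [::].
Proof. by split=> // x; rewrite andbF. Qed.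

Lemma vertices_done0 (t : 'I_m) L :
  nodes_done t L -> vertices_done t 0 (rcons L (t, [ffun=> ord0])).
Proof.
move=> [UL inL]; split.
  by rewrite rcons_uniq UL inL /= ltnn andbF.
move=> [s f]; rewrite mem_rcons inE inL /= xpair_eqE.
have -> : below f 0 = (f == [ffun=> ord0]).
  apply/belowP/eqP => [H|-> u]; last by rewrite ffunE eqxx.
  by apply/ffunP => u; rewrite ffunE; apply/eqP/negPn/negP => /H.
rewrite -val_eqE /=; case: eqP => [/val_inj -> |_] /=.
  by rewrite ltnn; case: eqP => [->|] /=; rewrite ?valid0 ?andbF.
by rewrite orbF.
Qed.

Lemma vertices_doneT (t : 'I_m) L : vertices_done t n L -> nodes_done t.+1 L.
Proof.
move=> [UL inL]; split=> // x; rewrite inL ltnS [in RHS]leq_eqVlt [in LHS]orbC.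
have -> : below x.2 n by apply/belowP => u _.
by rewrite andbT.
Qed.

Section Step.
Variables (t : 'I_m) (v : 'I_n) (L : seq record).
Hypothesis done_L : vertices_done t v L.

(* [x] extends one of the first [j] records of [L], or the record number [j] by
   one of the first [c] colours. *)
Definition fresh (j c : nat) x : bool :=
  [&& x.1 == t, valid t x.2, x.2 v != ord0, below x.2 v.+1 &
      let i := index (t, recolour x.2 v ord0) L in
      (i < j) || ((i == j) && (x.2 v <= c))].

Definition colours_done (j c : nat) L' : Prop :=
  exists E, [/\ L' = L ++ E, uniq L' & E =i fresh j c].

Lemma below_uncoloured f : below f v -> f v = ord0.
Proof. by move/belowP/(_ v) => H; apply/eqP/negPn/negP => /H; rewrite ltnn. Qed.

Lemma uncolour_mem f : valid t f -> below f v.+1 -> (t, recolour f v ord0) \in L.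
Proof.
move=> vf /belowP bf; rewrite (proj2 done_L) /= eqxx valid_uncolour //=.
apply/orP; right; apply/belowP => u; rewrite ffunE.
case: (u =P v) => [|uv /bf]; first by rewrite eqxx.
by rewrite ltnS leq_eqVlt => /orP[/eqP/val_inj|].
Qed.

(** Erasing [v] from a new record recovers the record it came from; the index of that record and the
    colour of [v] fix the moment of creation. *)
Lemma freshS j c x y0 : j < size L ->
  let y := nth y0 L j in let z := (t, recolour y.2 v (lift ord0 c)) in
  fresh j c.+1 x = fresh j c x || (extendable y t v c && (x == z)).
Proof.
have [UL inL] := done_L.
move=> jL; case E: (nth y0 L j) => [tj f] /=.
have : (tj, f) \in L by rewrite -E mem_nth.
rewrite inL /= => /andP[vf tjf].
apply/idP/orP => [/and5P[xt vx xv bx]|].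
  set i := index _ _ => /=; case: (ltngtP i j) => //= ij; rewrite ?orbF => xc.
    by left; rewrite /fresh xt vx xv bx /= -/i ij.
  move: xc; rewrite leq_eqVlt ltnS => /orP[/eqP xc|xc]; last first.
    by left; rewrite /fresh xt vx xv bx /= -/i ij eqxx xc orbT.
  right; have : nth y0 L i = (t, recolour x.2 v ord0).
    by rewrite nth_index // uncolour_mem.
  rewrite ij E => -[Et Ef]; subst tj.
  have fv : f v = ord0 by rewrite Ef ffunE eqxx.
  have xE : x.2 = recolour f v (lift ord0 c).
    apply/ffunP => u; rewrite Ef !ffunE; case: (u =P v) => // ->.
    by apply: ord_inj; rewrite xc lift0E.
  rewrite valid_recolour // -xE vx /=.
  by case: (x) xt xE => ? ? /= /eqP -> ->.
case=> [/and5P[xt vx xv bx]|/andP[ex /eqP ->]].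
  rewrite /fresh xt vx xv bx /= => /orP[->//|/andP[-> xc]].
  by rewrite (leq_trans xc) ?orbT.
have /eqP Et : tj == t by case/and4P: ex.
subst tj; rewrite ltnn eqxx /= in tjf.
have fv := below_uncoloured tjf.
have lt0 : (lift ord0 c == ord0) = false by rewrite eq_sym (negPf (neq_lift _ _)).
rewrite /fresh [(_, _).1]/= eqxx -valid_recolour // ex ffunE eqxx lt0 /=.
apply/andP; split.
  apply/belowP => u; rewrite ffunE; case: (u =P v) => [-> //|_ fu].
  by rewrite ltnS ltnW // (belowP _ _ tjf).
have -> : recolour (recolour f v (lift ord0 c)) v ord0 = f.
  by rewrite -[X in recolour _ v X]fv recolourK.
by rewrite -E index_uniq // eqxx leqnn orbT.
Qed.

Lemma colours_doneS j c L' y0 : j < size L -> colours_done j c L' ->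
  let y := nth y0 L' j in let z := (t, recolour y.2 v (lift ord0 c)) in
  colours_done j c.+1 (if extendable y t v c then rcons L' z else L').
Proof.
move=> jL [E [-> UE inE']] /=; rewrite nth_cat jL.
set y := nth y0 L j; set z := (t, _).
have inS x : (x \in fresh j c.+1) =
    (x \in fresh j c) || extendable y t v c && (x == z) := freshS c x y0 jL.
have [ex|nex] := boolP (extendable _ _ _ _).
  exists (rcons E z); rewrite rcons_cat; split=> //; last first.
    by move=> x; rewrite mem_rcons inE inE' inS ex orbC.
  (* The new record is not in [L], where [v] is uncoloured in all records of node [t], and not in
     [E], since record [j] has not yet been extended by colour [c + 1]. *)
  rewrite -rcons_cat rcons_uniq UE andbT mem_cat inE' negb_or.
  apply/andP; split.
    rewrite (proj2 done_L) /= ltnn eqxx /= negb_and; apply/orP; right.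
    apply/negP => /below_uncoloured; rewrite ffunE eqxx => /esym/eqP.
    by rewrite (negPf (neq_lift _ _)).
  apply/negP => /and5P[_ _ _ _]; rewrite /= ffunE eqxx lift0E ltnn andbF orbF.
  have /eqP Et : y.1 == t by case/and4P: ex.
  have yL : y \in L by rewrite mem_nth.
  have : below y.2 v by move: yL; rewrite (proj2 done_L) Et ltnn eqxx => /andP[].
  move=> /below_uncoloured yv; rewrite -[X in recolour _ v X]yv recolourK.
  rewrite -Et; have -> : (y.1, y.2) = y by case: (y).
  by rewrite index_uniq ?ltnn // (proj1 done_L).
by exists E; split=> // x; rewrite inE' inS (negPf nex) orbF.
Qed.

Lemma colours_done0 : colours_done 0 0 L.
Proof.
exists [::]; split=> [||x]; rewrite ?cats0 //; first exact: (proj1 done_L).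
rewrite in_nil; apply/esym/negP => /and5P[_ _ xv _ /=].
by rewrite ord_leq0 (negPf xv) andbF.
Qed.

Lemma colours_done_next j L' : colours_done j d L' -> colours_done j.+1 0 L'.
Proof.
move=> [E [-> UE inE']]; exists E; split=> // x; rewrite inE' /in_mem /= /fresh.
case: (x.1 == t); case: (valid _ _); case: (below _ _); rewrite /= ?andbF //.
have [//|xv] := eqVneq (x.2 v) ord0; have -> : x.2 v <= d by rewrite -ltnS.
rewrite andbT /=.
rewrite ord_leq0 (negPf xv) andbF orbF.
by rewrite [in RHS]ltnS [in RHS]leq_eqVlt [in LHS]orbC.
Qed.

Lemma colours_doneT L' : colours_done (size L) 0 L' -> vertices_done t v.+1 L'.
Proof.
have [UL inL] := done_L.
move=> [E [-> UE inE']]; split=> // x; rewrite mem_cat inE' inL /in_mem /= /fresh.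
rewrite -[x.1 == t]val_eqE /=; case: ltngtP => [xt|xt|/val_inj xt] /=;
  rewrite ?andbF ?orbF //.
rewrite xt; have [vx|] //= := boolP (valid t x.2).
apply/orP/idP => [[/belowP H|/and3P[] //]|bx].
  by apply/belowP => u /H /ltnW.
have [xv|xv] := eqVneq (x.2 v) ord0.
  left; apply/belowP => u xu; have := belowP _ _ bx u xu.
  by rewrite ltnS leq_eqVlt => /orP[/eqP/val_inj uv|//]; rewrite uv xv eqxx in xu.
by right; rewrite bx /= index_mem uncolour_mem.
Qed.

End Step.
End Enumeration.

(** * The algorithm *)

Local Notation "$ x" := (NGet x (NConst 0))
  (at level 5, x at level 0, only parsing).
Local Notation "c1 ;; c2" := (Then c1 c2)
  (at level 90, right associativity, only parsing).

Local Notation size_n := (NGet 0 (NConst 0)).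
Local Notation size_d := (NGet 0 (NConst 1)).
Local Notation size_m := (NGet 0 (NConst 2)).
Local Notation root := (NGet 0 (NConst 3)).

(* Array [out] marks the vertices that are still alive.  Record number [j]
   consists of the node in cell [j] of [node], the colours of the vertices in
   the cells from [j * n] on of [colr], and the value in cell [j] of [vals].
   The arrays from [cnt] on, and the real arrays from [acc] on, are scalars:
   only their cell [0] is used. *)
Local Notation adj := 1.
Local Notation chd := 2.
Local Notation inc := 3.
Local Notation out := 4.
Local Notation colr := 5.
Local Notation node := 6.
Local Notation cnt := 7.
Local Notation xt := 8.
Local Notation xv := 9.
Local Notation lim := 10.
Local Notation xj := 11.
Local Notation xc := 12.
Local Notation xu := 13.
Local Notation ok := 14.
Local Notation z1 := 15.
Local Notation z2 := 16.
Local Notation z3 := 17.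
Local Notation z4 := 18.
Local Notation z5 := 19.
Local Notation xi := 20.
Local Notation xq := 21.
Local Notation xg := 22.
Local Notation xm := 23.
Local Notation xy := 24.

Local Notation wgt := 0.
Local Notation vals := 1.
Local Notation acc := 2.
Local Notation best := 3.
Local Notation cur := 4.
Local Notation res := 5.
Local Notation opt := 6.

(* On [0/1]-valued cells truncated subtraction from [1] is negation, so that
   tests can be folded into assignments. *)
Definition NDist (a b : nexp) : nexp := NAdd (NSub a b) (NSub b a).
Definition NEq (a b : nexp) : bexp := BAnd (BLeN a b) (BLeN b a).
Definition NPos (a : nexp) : bexp := BLeN (NConst 1) a.
Definition NPut (x : nat) (a : nexp) : cmd := NSet x (NConst 0) a.
Definition RPut (x : nat) (a : rexp) : cmd := RSet x (NConst 0) a.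

(** The machine only adds. The factor [b] is always [n] or [m], so this loop stays within the
    budget. *)
Definition Mul (z : nat) (a b : nexp) : cmd :=
  NPut z (NConst 0) ;; For xm b (NPut z (NAdd $z a)).

(* Writes behind the last record the colouring of record [xj] extended by
   colour [xc + 1] for vertex [xv], as a record of node [xt], and commits it if
   it is valid. *)
Definition Try : cmd :=
  Mul z1 $xj size_n ;; Mul z2 $xv size_n ;; Mul z3 $xt size_n ;;
  Mul z4 $cnt size_n ;;
  NPut ok (NSub (NConst 1) (NAdd (NDist (NGet node $xj) $xt)
    (NSub (NConst 2) (NAdd (NGet inc (NAdd $z3 $xv)) (NGet out $xv))))) ;;
  For xu size_n
    (NSet colr (NAdd $z4 $xu) (NGet colr (NAdd $z1 $xu)) ;;
     NPut ok (NSub $ok (NSub (NGet adj (NAdd $z2 $xu))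
       (NDist (NGet colr (NAdd $z1 $xu)) (NAdd $xc (NConst 1)))))) ;;
  NSet colr (NAdd $z4 $xv) (NAdd $xc (NConst 1)) ;;
  NSet node $cnt $xt ;;
  NPut cnt (NAdd $cnt $ok).

Definition Blank : cmd :=
  Mul z4 $cnt size_n ;;
  For xu size_n (NSet colr (NAdd $z4 $xu) (NConst 0)) ;;
  NSet node $cnt $xt ;;
  NPut cnt (NAdd $cnt (NConst 1)).

(** [lim] freezes the length of the list: [Try] appends records during the scan, and these already
    colour [xv]. *)
Definition Extend : cmd :=
  NPut lim $cnt ;; For xj $lim (For xc size_d Try).

Definition Generate : cmd :=
  NPut cnt (NConst 0) ;; For xt size_m (Blank ;; For xv size_n Extend).

(** Record [xg] competes for [best] if it belongs to node [xq] and agrees with record [xj] on the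
    common vertices; [cur] collects its value and the weights it gains outside of the bag of
    [xj]. *)
Definition Compare : cmd :=
  Mul z1 $xj size_n ;; Mul z2 $xg size_n ;;
  Mul z3 (NGet node $xj) size_n ;; Mul z4 $xq size_n ;;
  NPut ok (NSub (NConst 1) (NDist (NGet node $xg) $xq)) ;;
  RPut cur (RGet vals $xg) ;;
  For xu size_n
    (NPut ok (NSub $ok (NSub
       (NAdd (NGet inc (NAdd $z3 $xu)) (NGet inc (NAdd $z4 $xu)))
       (NAdd (NConst 1) (NSub (NConst 1)
          (NDist (NGet colr (NAdd $z1 $xu)) (NGet colr (NAdd $z2 $xu))))))) ;;
     If (BAnd (NPos (NGet colr (NAdd $z2 $xu)))
              (BNot (NPos (NGet inc (NAdd $z3 $xu)))))
       (RPut cur (RAdd (RGet cur (NConst 0)) (RGet wgt $xu))) Skip) ;;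
  If (BAnd (NPos $ok) (BLeR (RGet best (NConst 0)) (RGet cur (NConst 0))))
    (RPut best (RGet cur (NConst 0))) Skip.

Definition Evaluate : cmd :=
  RPut acc RZero ;;
  For xq size_m
    (Mul z5 (NGet node $xj) size_m ;;
     If (NPos (NGet chd (NAdd $z5 $xq)))
       (RPut best RZero ;; For xg $cnt Compare ;;
        RPut acc (RAdd (RGet acc (NConst 0)) (RGet best (NConst 0))))
       Skip) ;;
  RSet vals $xj (RGet acc (NConst 0)).

(** The records are not sorted by depth, so all of them are evaluated [m] times; each round makes
    one more level correct, and stale values of an earlier call are overwritten. *)
Definition Solve : cmd :=
  Generate ;;
  For xi size_m (For xj $cnt Evaluate) ;;
  For xj $cnt
    (If (NEq (NGet node $xj) root) (RPut res (RGet vals $xj)) Skip).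

(* Deletes greedily every vertex whose deletion does not lower the optimum. *)
Definition Main : cmd :=
  For xy size_n (NSet out $xy (NConst 1)) ;;
  Solve ;; RPut opt (RGet res (NConst 0)) ;;
  For xy size_n
    (NSet out $xy (NConst 0) ;; Solve ;;
     If (BLeR (RGet opt (NConst 0)) (RGet res (NConst 0)))
       Skip (NSet out $xy (NConst 1))).

(** * Correctness of the program *)

Section Correctness.
Variables (R : realType) (n d m : nat) (e : rel 'I_n) (w : 'I_n -> R).
Variables (T : rel 'I_m) (r : 'I_m) (X : 'I_m -> {set 'I_n}).
Variable (B : nat).
Hypotheses (B_gt0 : 0 < B) (nB : n <= B) (dB : d <= B) (mB : m <= B).
Local Notation col := {ffun 'I_n -> 'I_d.+1}.
Local Notation record := ('I_m * col)%type.
Implicit Types (s : state R) (A : {set 'I_n}) (L : seq record).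

Lemma upd_same (C : Type) (M : nat -> nat -> C) x i a : upd M x i a x i = a.
Proof. by rewrite /upd !eqxx. Qed.

Lemma check_neqE (b1 b2 : bool) (x y : nat) :
  b1 - (b2 - (x - y + (y - x))) = b1 && ~~ (b2 && (x == y)).
Proof. by case: b1 b2 => -[]; case: eqP => /=; lia. Qed.

(** The final state is explicit, so that consecutive products are computed by simplification; [k]
    stands for the final counter, which is left open. *)
Lemma run_mul (z : nat) a b s (Q : state R -> Prop) :
  [&& z != xm, z \notin nreads a, xm \notin nreads a,
      z \notin nreads b & xm \notin nreads b] ->
  neval s b <= B ->
  (forall k, Q (nset (nset s xm 0 k) z 0 (neval s a * neval s b))) ->
  run B (Mul z a b) s Q.
Proof.
move=> /and5P[zm za ma zb mb] bB H.
pose st k p := nset (nset s xm 0 k) z 0 p.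
have ag k p : agree [:: z; xm] [::] s (st k p).
  by split=> // x i; rewrite !inE negb_or /= /upd => /andP[/negPf -> /negPf ->].
have rds c : z \notin nreads c -> xm \notin nreads c ->
    all (fun y => y \notin [:: z; xm]) (nreads c).
  move=> zc mc; apply/allP => y yc; rewrite !inE negb_or.
  by apply/andP; split; [apply: contraNneq zc | apply: contraNneq mc] => <-.
have ra k p := neval_agree (ag k p) (rds _ za ma).
have rb k p := neval_agree (ag k p) (rds _ zb mb).
apply/(run_then B_gt0)/run_nset => /=.
have b0 : neval (nset s z 0 0) b = neval s b.
  apply: (@neval_agree _ [:: z; xm] [::]); last exact: rds.
  by split=> // x i; rewrite !inE negb_or /= /upd => /andP[/negPf ->].
apply: (run_for B_gt0 (I := fun i s' => s' = st i (neval s a * i))).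
- rewrite /= inE eq_sym zm /=; apply: sub_all (rds _ zb mb) => y.
  by rewrite !inE orbC.
- by rewrite b0.
- rewrite muln0 /st /nset /=; congr State; apply/boolp.funext => x.
  apply/boolp.funext => i; rewrite /upd.
  have [->|] := eqVneq x z; last by [].
  by rewrite (negPf zm).
- move=> i s' _ _ _ ->; apply: run_nset.
  rewrite /= ra /st /nset /= upd_same -mulnSr; congr State.
  apply/boolp.funext => x; apply/boolp.funext => j; rewrite /upd.
  have [->|] := eqVneq x z; last by case: (x == xm); case: (j == 0).
  by rewrite (negPf zm); case: (j == 0).
- by move=> s' _ ->; rewrite b0; apply: H.
Qed.

Lemma run_for_ord (I : nat -> state R -> Prop) J x a c s (Q : state R -> Prop) :
  (x \notin nmods c) && all (fun y => y \notin x :: nmods c) (nreads a) ->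
  neval s a = J -> J <= B -> I 0 (nset s x 0 0) ->
  (forall (i : 'I_J) s', nmem s' x 0 = i ->
     agree (x :: nmods c) (rmods c) s s' -> I i s' ->
     run B c s' (fun s'' => I i.+1 (nset s'' x 0 i.+1))) ->
  (forall s', agree (x :: nmods c) (rmods c) s s' -> I J s' -> Q s') ->
  run B (For x a c) s Q.
Proof.
move=> H aJ JB I0 step fin; apply: (run_for B_gt0 (I := I)) => //; rewrite aJ //.
by move=> i s' iJ; apply: (step (Ordinal iJ)).
Qed.

Lemma forall_ltS J (P : pred 'I_J) (i : 'I_J) :
  [forall u : 'I_J, (u < i.+1) ==> P u] =
  [forall u : 'I_J, (u < i) ==> P u] && P i.
Proof.
apply/forallP/andP => [H|[/forallP H Pi] u].
  split; last by have := H i; rewrite ltnSn.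
  by apply/forallP => u; apply/implyP => ui; have := H u; rewrite ltnS ltnW.
apply/implyP; rewrite ltnS leq_eqVlt => /orP[/eqP/val_inj -> //|ui].
by have := H u; rewrite ui.
Qed.

Lemma forall_lt0 J (P : pred 'I_J) : [forall u : 'I_J, (u < 0) ==> P u].
Proof. by apply/forallP. Qed.

Lemma forall_lt J (P : pred 'I_J) :
  [forall u : 'I_J, (u < J) ==> P u] = [forall u, P u].
Proof. by apply: eq_forallb => u; rewrite ltn_ord. Qed.

Definition Env s : Prop :=
  [/\ [/\ nmem s 0 0 = n, nmem s 0 1 = d, nmem s 0 2 = m & nmem s 0 3 = r],
      forall u v : 'I_n, nmem s adj (u * n + v) = e u v,
      forall t u : 'I_m, nmem s chd (t * m + u) = child T r t u,
      forall (t : 'I_m) (v : 'I_n), nmem s inc (t * n + v) = (v \in X t) &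
      forall v : 'I_n, rmem s wgt v = w v].

Definition Alive A s : Prop := forall v : 'I_n, nmem s out v = (v \in A).

Definition at_ L j : record := nth (r, [ffun=> ord0]) L j.

Definition Cells L s : Prop :=
  forall j, j < size L ->
    nmem s node j = (at_ L j).1 /\
    forall v : 'I_n, nmem s colr (j * n + v) = (at_ L j).2 v.

Definition Records L s : Prop := nmem s cnt 0 = size L /\ Cells L s.

Lemma env_agree xs ys s s' :
  agree xs ys s s' -> all (fun x => x \notin xs) (iota 0 4) -> wgt \notin ys ->
  Env s -> Env s'.
Proof.
move=> [ag1 ag2] /and5P[x0 x1 x2 x3 _] y0 [[h1 h2 h3 h4] h5 h6 h7 h8].
by split=> [|*|*|*|*]; rewrite ?ag1 ?ag2.
Qed.

Lemma alive_agree xs ys s s' A :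
  agree xs ys s s' -> out \notin xs -> Alive A s -> Alive A s'.
Proof. by move=> [ag1 _] x0 H v; rewrite ag1. Qed.

Lemma cells_agree xs ys s s' L :
  agree xs ys s s' -> all (fun x => x \notin xs) [:: colr; node] ->
  Cells L s -> Cells L s'.
Proof.
move=> [ag1 _] /and3P[x5 x6 _] H j jL.
by rewrite ag1 //; have [-> H'] := H j jL; split=> // v; rewrite ag1.
Qed.

Lemma records_agree xs ys s s' L :
  agree xs ys s s' -> all (fun x => x \notin xs) (iota 5 3) ->
  Records L s -> Records L s'.
Proof.
move=> ag /and4P[x5 x6 x7 _] [c H]; split; first by rewrite (proj1 ag).
by apply: cells_agree ag _ H; rewrite /= x5 x6.
Qed.

(** Cells behind the last record are scratch space; therefore a candidate can be written before its
    validity is known. *)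
Lemma cells_colr L s i a :
  size L * n <= i -> Cells L s -> Cells L (nset s colr i a).
Proof.
move=> Li H j jL; have [Hn Hc] := H j jL; split=> // v; rewrite /= /upd /=.
case: eqP => [E|_]; last exact: Hc.
suff: j * n + v < size L * n by rewrite E ltnNge Li.
by apply: (@leq_trans (j.+1 * n)); rewrite ?leq_mul2r ?jL ?orbT // mulSn addnC ltn_add2r.
Qed.

Lemma cells_node L s a : Cells L s -> Cells L (nset s node (size L) a).
Proof.
move=> H j jL; have [Hn Hc] := H j jL; split=> //; rewrite /= /upd.
by rewrite (ltn_eqF jL) Hn.
Qed.

Lemma cells_rcons L s (t : 'I_m) (f : col) :
  Cells L s -> nmem s node (size L) = t ->
  (forall v : 'I_n, nmem s colr (size L * n + v) = f v) ->
  Cells (rcons L (t, f)) s.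
Proof.
move=> H Ht Hf j; rewrite size_rcons ltnS leq_eqVlt /at_ nth_rcons.
case: ltnP => [jL _|Lj /orP[/eqP ->|]]; [exact: H | by rewrite eqxx | by []].
Qed.

Lemma run_try A L j (t : 'I_m) (v : 'I_n) (c : 'I_d) s (Q : state R -> Prop) :
  Env s -> Alive A s -> Records L s -> nmem s xt 0 = t -> nmem s xv 0 = v ->
  nmem s xj 0 = j -> j < size L -> nmem s xc 0 = c ->
  (forall s', agree (nmods Try) (rmods Try) s s' ->
     Records (if extendable e X A (at_ L j) t v c
              then rcons L (t, recolour (at_ L j).2 v (lift ord0 c)) else L) s' -> Q s') ->
  run B Try s Q.
Proof.
move=> Es As [cs Cs] Et Ev Ej jL Ec HQ; apply/run_frame.
have [[En Ed Em Er] Eadj Echd Einc Ew] := Es.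
have [Hn Hc] := Cs j jL.
move Ex: (at_ L j) Hn Hc => x; case: x Ex => tj f Ex /= Hn Hc.
rewrite /Try.
apply/(run_then B_gt0)/run_mul; [by []|by rewrite /= /upd /= En|].
move=> k1; rewrite /= /upd /= Ej En.
apply/(run_then B_gt0)/run_mul; [by []|by rewrite /= /upd /= En|].
move=> k2; rewrite /= /upd /= Ev En.
apply/(run_then B_gt0)/run_mul; [by []|by rewrite /= /upd /= En|].
move=> k3; rewrite /= /upd /= Et En.
apply/(run_then B_gt0)/run_mul; [by []|by rewrite /= /upd /= En|].
move=> k4; rewrite /= /upd /= cs En.
apply/(run_then B_gt0)/run_nset; rewrite /= /upd /= Ej Et Ev Hn Einc As.
pose b0 := [&& tj == t, v \in X t & v \in A].
(* Every failed condition adds at least [1] to the subtrahend, so [ok] starts at [1] only if none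
   fails. *)
have -> : 1 - (tj - t + (t - tj) + (2 - ((v \in X t) + (v \in A)))) = b0.
  rewrite /b0 -val_eqE /=; case: (v \in X t); case: (v \in A); case: eqP => /=; lia.
set s5 := nset _ ok 0 b0.
have Cs5 : Cells L s5 by exact: Cs.
apply/run_then => //; apply: (run_for_ord (J := n) (I := fun i s' => [/\ Cells L s',
    forall u : 'I_n, u < i -> nmem s' colr (size L * n + u) = f u &
    nmem s' ok 0 = b0 && [forall u : 'I_n,
      (u < i) ==> ~~ (e v u && (f u == lift ord0 c))]])) => //.
- by split=> //; rewrite forall_lt0 andbT.
- move=> u s' Eu ag [Cs' fs' oks'].
  have E1 : nmem s' z1 0 = j * n by rewrite (proj1 ag).
  have E2 : nmem s' z2 0 = v * n by rewrite (proj1 ag).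
  have E4 : nmem s' z4 0 = size L * n by rewrite (proj1 ag).
  have Ec' : nmem s' xc 0 = c by rewrite (proj1 ag).
  have Ef : nmem s' colr (j * n + u) = f u.
    by have [_ ->] := Cs' j jL; rewrite Ex.
  have Ea : nmem s' adj (v * n + u) = e v u by rewrite (proj1 ag) //; exact: Eadj.
  apply/(run_then B_gt0)/run_nset; rewrite /= Eu E1 E4 Ef.
  (* The cell read here contains [f u] whether or not it is the one just written. *)
  apply/run_nset; rewrite /= /upd /= Eu E1 E2 Ec' oks' Ea Ef if_same.
  split.
  + by have := cells_colr (f u) (leq_addr u (size L * n)) Cs'.
  + move=> u0; rewrite ltnS leq_eqVlt eqn_add2l => /orP[/eqP/val_inj ->|u0u].
      by rewrite eqxx.
    by rewrite (ltn_eqF u0u) fs'.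
  + have El : (f u == lift ord0 c) = (f u == c.+1 :> nat) by rewrite -lift0E.
    rewrite forall_ltS El.
    by rewrite addn1 check_neqE andbA.
move=> s6 ag6 [Cs6 fs6 ok6].
have E1 : nmem s6 z4 0 = size L * n by rewrite (proj1 ag6).
have E2 : nmem s6 xv 0 = v by rewrite (proj1 ag6).
have E3 : nmem s6 xc 0 = c by rewrite (proj1 ag6).
have E4 : nmem s6 cnt 0 = size L by rewrite (proj1 ag6).
have E5 : nmem s6 xt 0 = t by rewrite (proj1 ag6).
apply/(run_then B_gt0)/run_nset; rewrite /= E1 E2 E3.
apply/(run_then B_gt0)/run_nset; rewrite /= /upd /= E4 E5.
apply/run_nset; rewrite /= /upd /= E4 ok6 forall_lt.
set s7 := nset _ node _ _; set good := _ && _.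
have -> : good = extendable e X A (tj, f) t v c.
  by rewrite /good /extendable /= -!andbA.
have Cs7 : Cells L s7 by apply/cells_node/cells_colr => //; exact: leq_addr.
move=> ag; apply: HQ ag _; rewrite Ex /=.
case: (extendable _ _ _ _ _); last by split=> //=; rewrite addn0.
split; first by rewrite size_rcons /= /upd /= addn1.
apply: (cells_rcons (s := nset s7 cnt 0 _)) => //=.
  by rewrite /upd /= eqxx.
move=> u; rewrite /upd /= eqn_add2l ffunE -val_eqE /=.
by case: eqP => _; rewrite ?lift0E ?addn1 // fs6.
Qed.


Lemma run_blank L (t : 'I_m) s (Q : state R -> Prop) :
  Env s -> Records L s -> nmem s xt 0 = t ->
  (forall s', agree (nmods Blank) (rmods Blank) s s' ->
     Records (rcons L (t, [ffun=> ord0])) s' -> Q s') ->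
  run B Blank s Q.
Proof.
move=> Es [cs Cs] Et HQ; apply/run_frame.
have [[En Ed Em Er] _ _ _ _] := Es.
apply/(run_then B_gt0)/run_mul; [by []|by rewrite /= En|].
move=> k; rewrite /= cs En; set s1 := nset _ z4 0 _.
have Cs1 : Cells L s1 by exact: Cs.
apply/run_then => //; apply: (run_for_ord (J := n) (I := fun i s' => Cells L s' /\
    forall u : 'I_n, u < i -> nmem s' colr (size L * n + u) = 0)) => //.
  move=> u s' Eu ag [Cs' H].
  have E4 : nmem s' z4 0 = size L * n by rewrite (proj1 ag).
  apply/run_nset; rewrite /= Eu E4; split.
    by have := cells_colr 0 (leq_addr u (size L * n)) Cs'.
  move=> u0; rewrite /upd /= ltnS leq_eqVlt eqn_add2l => /orP[/eqP/val_inj ->|u0u].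
    by rewrite eqxx.
  by rewrite (ltn_eqF u0u) H.
move=> s2 ag2 [Cs2 H2].
have E4 : nmem s2 cnt 0 = size L by rewrite (proj1 ag2).
have E5 : nmem s2 xt 0 = t by rewrite (proj1 ag2).
apply/(run_then B_gt0)/run_nset; rewrite /= E4 E5.
apply/run_nset; rewrite /= /upd /= E4 addn1 => ag; apply: HQ ag _.
split; first by rewrite size_rcons.
apply: (cells_rcons (s := nset (nset s2 node (size L) t) cnt 0 _)) => //=.
- exact: (cells_node t Cs2).
- by rewrite /upd /= eqxx.
- by move=> v; rewrite /upd /= ffunE H2.
Qed.

Hypothesis simple_e : simple_graph e.
Variable A : {set 'I_n}.
Hypothesis card_B : forall L, uniq L ->
  (forall x, x \in L -> valid e X A x.1 x.2) -> size L <= B.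

Lemma run_extend L (t : 'I_m) (v : 'I_n) s (Q : state R -> Prop) :
  Env s -> Alive A s -> Records L s -> vertices_done e X A t v L ->
  nmem s xt 0 = t -> nmem s xv 0 = v ->
  (forall s' L', agree (nmods Extend) (rmods Extend) s s' ->
     Records L' s' -> vertices_done e X A t v.+1 L' -> Q s') ->
  run B Extend s Q.
Proof.
move=> Es As Rs VL Et Ev HQ; apply/run_frame.
have LB : size L <= B.
  by apply: card_B => [|x]; [case: VL | case: VL => _ -> /andP[]].
apply/(run_then B_gt0)/run_nset => /=; have [-> _] := Rs.
apply: (run_for_ord (J := size L) (I := fun j s' => exists2 L',
  Records L' s' & colours_done e X A t v L j 0 L')) => //.
- by exists L => //; exact: colours_done0.
- move=> j s1 Ej ag1 [L1 R1 C1].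
  have Es1 : Env s1 by exact: env_agree ag1 _ _ Es.
  have As1 : Alive A s1 by exact: alive_agree ag1 _ As.
  have [[_ Ed _ _] _ _ _ _] := Es1.
  apply: (run_for_ord (J := d) (I := fun c s' => exists2 L',
    Records L' s' & colours_done e X A t v L j c L')) => //.
  + by exists L1.
  + move=> c s2 Ec ag2 [L2 R2 C2].
    have jL2 : j < size L2.
      by have [E [-> _ _]] := C2; rewrite size_cat ltn_addr.
    have Es2 : Env s2 by exact: env_agree ag2 _ _ Es1.
    have As2 : Alive A s2 by exact: alive_agree ag2 _ As1.
    apply: (run_try (t := t) (v := v) (c := c) Es2 As2 R2 _ _ _ jL2) => //.
    * by rewrite (proj1 ag2) // (proj1 ag1).
    * by rewrite (proj1 ag2) // (proj1 ag1).
    * by rewrite (proj1 ag2).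
    * move=> s3 ag3 R3; eexists; first exact: R3.
      exact: (colours_doneS simple_e VL (r, [ffun=> ord0]) (ltn_ord j) C2).
  + move=> s2 ag2 [L2 R2 C2]; exists L2; first exact: R2.
    exact: colours_done_next C2.
- move=> s1 ag1 [L1 R1 C1] ag; apply: HQ ag R1 _; exact: (colours_doneT VL C1).
Qed.

Lemma run_generate s (Q : state R -> Prop) :
  Env s -> Alive A s ->
  (forall s' L, agree (nmods Generate) (rmods Generate) s s' ->
     Records L s' -> nodes_done e X A m L -> Q s') ->
  run B Generate s Q.
Proof.
move=> Es As HQ; apply/run_frame.
have [[_ _ Em _] _ _ _ _] := Es.
apply/(run_then B_gt0)/run_nset => /=.
apply: (run_for_ord (J := m) (I := fun t s' => exists2 L,
  Records L s' & nodes_done e X A t L)) => //.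
- by exists [::] => //; exact: nodes_done0.
- move=> t s1 Et ag1 [L1 R1 N1].
  have Es1 : Env s1 by exact: env_agree ag1 _ _ Es.
  have As1 : Alive A s1 by exact: alive_agree ag1 _ As.
  apply: (run_then B_gt0); apply: (run_blank Es1 R1 Et) => s2 ag2 R2.
  have Es2 : Env s2 by exact: env_agree ag2 _ _ Es1.
  have As2 : Alive A s2 by exact: alive_agree ag2 _ As1.
  have [[En _ _ _] _ _ _ _] := Es2.
  apply: (run_for_ord (J := n) (I := fun v s' => exists2 L,
    Records L s' & vertices_done e X A t v L)) => //.
  + by eexists; [exact: R2 | exact: vertices_done0].
  + move=> v s3 Ev ag3 [L3 R3 V3].
    have Es3 : Env s3 by exact: env_agree ag3 _ _ Es2.
    have As3 : Alive A s3 by exact: alive_agree ag3 _ As2.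
    apply: (run_extend Es3 As3 R3 V3) => //.
      by rewrite (proj1 ag3) // (proj1 ag2).
    by move=> s4 L4 _ R4 V4; exists L4.
  + by move=> s3 _ [L3 R3 V3]; exists L3 => //; exact: vertices_doneT.
- by move=> s1 _ [L1 R1 N1] ag; apply: HQ ag R1 N1.
Qed.

(** * Evaluating the recursion on the list of records *)

Lemma sum_ltS J (P : pred 'I_J) (F : 'I_J -> R) (i : 'I_J) :
  (\sum_(u : 'I_J | (u < i.+1)%N && P u) F u =
   \sum_(u : 'I_J | (u < i)%N && P u) F u + (if P i then F i else 0))%R.
Proof.
have ltE (u : 'I_J) : (u < i.+1) = (u == i) || (u < i).
  by rewrite ltnS leq_eqVlt val_eqE.
case: ifP => Pi; last first.
  rewrite addr0; apply: eq_bigl => u; rewrite ltE; case: eqP => // ->.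
  by rewrite Pi !andbF.
rewrite (bigD1 i) /= ?ltnSn // addrC; congr (_ + _)%R; apply: eq_bigl => u.
rewrite ltE; case: eqP => [->|_]; first by rewrite ltnn !andbF.
by rewrite andbT.
Qed.

Lemma bigmax_rcons (I : Type) (l : seq I) y (P : pred I) (G : I -> R) :
  (\big[Num.max/0]_(x <- rcons l y | P x) G x =
   if P y then Num.max (\big[Num.max/0]_(x <- l | P x) G x) (G y)
   else \big[Num.max/0]_(x <- l | P x) G x)%R.
Proof.
elim: l => [|x l IH]; rewrite /= !big_cons ?big_nil; last first.
  by rewrite IH; case: (P x); case: (P y) => //; rewrite maxA.
by case: ifP => //; rewrite maxC.
Qed.

Lemma check_compatE (b b1 b2 : bool) (x y : nat) :
  b - (b1 + b2 - (1 + (1 - (x - y + (y - x))))) = b && (b1 && b2 ==> (x == y)).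
Proof. by case: b b1 b2 => -[] []; case: eqP => /=; lia. Qed.

Lemma check_eqE (x y : nat) : 1 - (x - y + (y - x)) = (x == y).
Proof. by case: eqP; lia. Qed.

Definition best_below L (F : nat -> R) (j : nat) (q : 'I_m) (g : nat) : R :=
  (\big[Num.max/0]_(k < g | ((at_ L k).1 == q) &&
      compat X (at_ L j).1 q (at_ L j).2 (at_ L k).2)
    (gain w X (at_ L j).1 (at_ L k).2 + F k))%R.

Lemma run_compare L j (q : 'I_m) g s (Q : state R -> Prop) :
  Env s -> Records L s -> nmem s xj 0 = j -> j < size L ->
  nmem s xq 0 = q -> nmem s xg 0 = g -> g < size L ->
  rmem s best 0 = best_below L (rmem s vals) j q g ->
  (forall s', agree (nmods Compare) (rmods Compare) s s' ->
     rmem s' best 0 = best_below L (rmem s vals) j q g.+1 -> Q s') ->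
  run B Compare s Q.
Proof.
move=> Es [cs Cs] Ej jL Eq Eg gL Eb HQ; apply/run_frame.
have [[En Ed Em Er] Eadj Echd Einc Ew] := Es.
have [Hnj Hcj] := Cs j jL; have [Hng Hcg] := Cs g gL.
set b0 := best_below _ _ _ _ _ in Eb.
have bstS : best_below L (rmem s vals) j q g.+1 =
    if ((at_ L g).1 == q) && compat X (at_ L j).1 q (at_ L j).2 (at_ L g).2
    then Num.max b0 (gain w X (at_ L j).1 (at_ L g).2 + rmem s vals g)%R else b0.
  rewrite /b0 /best_below -(big_mkord (fun k => ((at_ L k).1 == q) &&
    compat X (at_ L j).1 q (at_ L j).2 (at_ L k).2)
    (fun k => gain w X (at_ L j).1 (at_ L k).2 + rmem s vals k)%R).
  rewrite -[in RHS](big_mkord (fun k => ((at_ L k).1 == q) &&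
    compat X (at_ L j).1 q (at_ L j).2 (at_ L k).2)
    (fun k => gain w X (at_ L j).1 (at_ L k).2 + rmem s vals k)%R).
  by rewrite /index_iota !subn0 -addn1 iotaD add0n cats1 bigmax_rcons.
rewrite {}bstS in HQ.
move: (at_ L j) (at_ L g) Hnj Hcj Hng Hcg HQ => [tj fj] [tg fg] /= Hnj Hcj Hng Hcg HQ.
apply/(run_then B_gt0)/run_mul; [by []|by rewrite /= /upd /= En|].
move=> k1; rewrite /= /upd /= Ej En.
apply/(run_then B_gt0)/run_mul; [by []|by rewrite /= /upd /= En|].
move=> k2; rewrite /= /upd /= Eg En.
apply/(run_then B_gt0)/run_mul; [by []|by rewrite /= /upd /= En|].
move=> k3; rewrite /= /upd /= Ej Hnj En.
apply/(run_then B_gt0)/run_mul; [by []|by rewrite /= /upd /= En|].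
move=> k4; rewrite /= /upd /= Eq En.
apply/(run_then B_gt0)/run_nset; rewrite /= /upd /= Eg Hng Eq check_eqE val_eqE.
apply/(run_then B_gt0)/run_rset; rewrite /= /upd /= Eg.
set s5 := rset _ cur 0 _.
apply/run_then => //; apply: (run_for_ord (J := n) (I := fun i s' => 
    nmem s' ok 0 = (tg == q) && [forall u : 'I_n, (u < i) ==>
       ((u \in X tj) && (u \in X q) ==> (fj u == fg u))] /\
    rmem s' cur 0 = (rmem s vals g + \sum_(u : 'I_n |
      (u < i)%N && ((u \notin X tj) && (fg u != ord0))) w u)%R)) => //.
- split; first by rewrite forall_lt0 andbT.
  by rewrite big_pred0 ?addr0.
- move=> u s' Eu ag [oks' curs'].
  have E1 : nmem s' z1 0 = j * n by rewrite (proj1 ag).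
  have E2 : nmem s' z2 0 = g * n by rewrite (proj1 ag).
  have E3 : nmem s' z3 0 = tj * n by rewrite (proj1 ag).
  have E4 : nmem s' z4 0 = q * n by rewrite (proj1 ag).
  have Efj : nmem s' colr (j * n + u) = fj u by rewrite (proj1 ag) //; exact: Hcj.
  have Efg : nmem s' colr (g * n + u) = fg u by rewrite (proj1 ag) //; exact: Hcg.
  have E5 : nmem s' inc (tj * n + u) = (u \in X tj) by rewrite (proj1 ag) //; exact: Einc.
  have E6 : nmem s' inc (q * n + u) = (u \in X q) by rewrite (proj1 ag) //; exact: Einc.
  have E7 : rmem s' wgt u = w u by rewrite (proj2 ag) //; exact: Ew.
  apply/(run_then B_gt0)/run_nset; rewrite /= Eu E1 E2 E3 E4 Efj Efg E5 E6 oks'.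
  rewrite check_compatE -andbA (_ : (fj u == fg u :> nat) = (fj u == fg u)) //.
  rewrite -(forall_ltS (fun u => (u \in X tj) && (u \in X q) ==> (fj u == fg u))).
  apply: (run_if B_gt0); rewrite /= /upd /= Eu E2 E3 Efg E5 => H.
    apply/run_rset; rewrite /= /upd /= Eu E7 curs'; split=> //.
    rewrite sum_ltS; move: H; rewrite lt0b lt0n => /andP[fu ->] /=.
    by rewrite -val_eqE fu addrA.
  apply/run_skip; split=> //=; rewrite curs' sum_ltS.
  by move: H; rewrite lt0b lt0n andbC -val_eqE => /negPf ->; rewrite addr0.
move=> s6 ag6 []; rewrite forall_lt => ok6 cur6.
rewrite -/(compat X tj q fj fg) in ok6.
have {}cur6 : rmem s6 cur 0 = (gain w X tj fg + rmem s vals g)%R.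
  rewrite cur6 addrC; congr (_ + _)%R; apply: eq_bigl => u.
  by rewrite ltn_ord.
have best6 : rmem s6 best 0 = b0 by rewrite (proj2 ag6).
apply: (run_if B_gt0); rewrite /= ok6 cur6 best6 lt0b => H.
  apply: run_rset => ag; apply: HQ ag _; case/andP: H => -> le_b.
  by rewrite /= upd_same cur6; apply/esym/max_r.
apply: run_skip => ag; apply: HQ ag _; rewrite best6.
by case: ifP H => //= _; rewrite -ltNge => /ltW/max_l ->.
Qed.

(** The new value is accumulated in [acc] and stored last, so all reads during the loops see the old
    array. *)
Lemma run_evaluate L j s (Q : state R -> Prop) :
  Env s -> Records L s -> size L <= B -> nmem s xj 0 = j -> j < size L ->
  (forall s', agree (nmods Evaluate) (rmods Evaluate) s s' ->
     (forall k, rmem s' vals k = if k == j then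
        (\sum_(u | child T r (at_ L j).1 u)
           best_below L (rmem s vals) j u (size L))%R
        else rmem s vals k) -> Q s') ->
  run B Evaluate s Q.
Proof.
move=> Es Rs LB Ej jL HQ; apply/run_frame.
have [[En Ed Em Er] Eadj Echd Einc Ew] := Es.
apply/(run_then B_gt0)/run_rset => /=; set s0 := rset _ _ _ _.
have Es0 : Env s0 by exact: Es.
have Rs0 : Records L s0 by exact: Rs.
apply/run_then => //; apply: (run_for_ord (J := m) (I := fun q s' =>
  rmem s' vals =1 rmem s vals /\
  rmem s' acc 0 = (\sum_(u : 'I_m | (u < q)%N && child T r (at_ L j).1 u)
    best_below L (rmem s vals) j u (size L))%R)) => //.
- by split=> //; rewrite big_pred0.
- move=> q s1 Eq ag1 [vals1 acc1].
  have Es1 : Env s1 by exact: env_agree ag1 _ _ Es0.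
  have Rs1 : Records L s1 by exact: records_agree ag1 _ Rs0.
  have Ej1 : nmem s1 xj 0 = j by rewrite (proj1 ag1).
  have [[_ _ Em1 _] _ Echd1 _ _] := Es1.
  have [cs1 Cs1] := Rs1; have [Hnj _] := Cs1 j jL.
  apply/(run_then B_gt0)/run_mul; [by []|by rewrite /= /upd /= Em1|].
  move=> k1; rewrite /= Ej1 Hnj Em1; set s2 := nset _ z5 0 _.
  apply: (run_if B_gt0); rewrite /= /upd /= Eq Echd1 lt0b => cq; last first.
    apply: run_skip; split=> //.
    by rewrite /= sum_ltS (negPf cq) addr0.
  apply/(run_then B_gt0)/run_rset => /=; set s3 := rset _ _ _ _.
  have Es3 : Env s3 by exact: Es1.
  have Rs3 : Records L s3 by exact: Rs1.
  apply/run_then => //; apply: (run_for_ord (J := size L) (I := fun g s' =>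
    rmem s' vals =1 rmem s vals /\
    rmem s' best 0 = best_below L (rmem s vals) j q g)) => //.
  + by split=> //; rewrite /best_below big_ord0.
  + move=> g s4 Eg ag4 [vals4 best4].
    have Es4 : Env s4 by exact: env_agree ag4 _ _ Es3.
    have Rs4 : Records L s4 by exact: records_agree ag4 _ Rs3.
    have bE g' : best_below L (rmem s4 vals) j q g' = best_below L (rmem s vals) j q g'.
      by apply: eq_bigr => k _; rewrite vals4.
    apply: (run_compare (j := j) (q := q) (g := g) Es4 Rs4) => //.
    * by rewrite (proj1 ag4).
    * by rewrite (proj1 ag4).
    * by rewrite bE.
    * move=> s5 ag5; rewrite bE => best5; split=> // k.
      by rewrite /= (proj2 ag5).
  + move=> s4 ag4 [vals4 best4].
    apply: run_rset; rewrite /= /upd /=; split=> //.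
    by rewrite sum_ltS cq best4 -acc1 (proj2 ag4).
move=> s1 ag1 [vals1 acc1].
have Ej1 : nmem s1 xj 0 = j by rewrite (proj1 ag1).
apply: run_rset => ag; apply: HQ ag _ => k; rewrite /= /upd /= Ej1 acc1 vals1.
by case: eqP => // _; apply: eq_bigl => u; rewrite ltn_ord.
Qed.

Hypotheses (treeT : is_tree T) (Xr : X r = set0).
Local Notation value := (value e w r X A treeT).

(** The rounds lower [i] from [m], where the claim is vacuous because all depths are below [m], to
    [0]. *)
Definition correct_from L (i : nat) s : Prop :=
  forall k, k < size L -> i <= depth r treeT (at_ L k).1 ->
    rmem s vals k = value (at_ L k).1 (at_ L k).2.

(** The records of [u] in the list are exactly the valid colourings of its bag, and [F] has to be
    correct on these only. *)
Lemma best_belowE L F j (u : 'I_m) : nodes_done e X A m L ->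
  (forall k, k < size L -> (at_ L k).1 = u -> F k = value u (at_ L k).2) ->
  best_below L F j u (size L) =
  (\big[Num.max/0]_(g | valid e X A u g && compat X (at_ L j).1 u (at_ L j).2 g)
     (gain w X (at_ L j).1 g + value u g))%R.
Proof.
move=> [UL inL] FE; apply/eqP; rewrite eq_le; apply/andP; split.
  apply: bigmax_le; first exact: bigmax_ge_id.
  move=> k /andP[/eqP ku ck]; rewrite FE //.
  apply: (le_bigmax_cond _ (fun g => gain w X (at_ L j).1 g + value u g)%R).
  rewrite ck andbT; have : at_ L k \in L by rewrite mem_nth.
  by rewrite inL ku => /andP[].
apply: bigmax_le; first exact: bigmax_ge_id.
move=> g /andP[vg cg].
have gL : (u, g) \in L by rewrite inL /= vg ltn_ord.
have iL : index (u, g) L < size L by rewrite index_mem.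
have Eg : at_ L (Ordinal iL) = (u, g) by rewrite /at_ nth_index.
have <- : F (Ordinal iL) = value u g by rewrite FE // Eg.
apply: bigmax_sup (Ordinal iL) _ _ _ _ _; rewrite Eg /= ?eqxx ?cg //.
Qed.

Lemma run_round L i s (Q : state R -> Prop) :
  Env s -> Records L s -> nodes_done e X A m L -> i < m ->
  correct_from L (m - i) s ->
  (forall s', agree (xj :: nmods Evaluate) (rmods Evaluate) s s' ->
     correct_from L (m - i.+1) s' -> Q s') ->
  run B (For xj $cnt Evaluate) s Q.
Proof.
move=> Es Rs NL im cor HQ.
have LB : size L <= B.
  by apply: card_B => [|x]; [case: NL | case: NL => _ -> /andP[]].
(* The array is updated in place: values already correct are recomputed from correct ones and must
   stay so, while the records processed gain one more level. *)
apply: (run_for_ord (J := size L) (I := fun j s' => correct_from L (m - i) s' /\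
   forall k, k < j -> k < size L -> m - i.+1 <= depth r treeT (at_ L k).1 ->
     rmem s' vals k = value (at_ L k).1 (at_ L k).2)) => //.
- by case: Rs.
- move=> j s1 Ej ag1 [c1 d1].
  have Es1 : Env s1 by exact: env_agree ag1 _ _ Es.
  have Rs1 : Records L s1 by exact: records_agree ag1 _ Rs.
  apply: (run_evaluate (j := j) Es1 Rs1) => // s2 _ v2.
  have vj : m - i.+1 <= depth r treeT (at_ L j).1 ->
      rmem s2 vals j = value (at_ L j).1 (at_ L j).2.
    move=> dj; rewrite v2 eqxx valueE; apply: eq_bigr => u cu.
    apply: best_belowE => // k kL ku; rewrite c1 ?ku //.
    by rewrite (depth_child treeT cu) -(subnSK im) ltnS.
  split=> [k kL dk|k]; rewrite /=.
    have [Ek|kj] := eqVneq k j; last by rewrite v2 (negPf kj) c1.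
    by rewrite Ek in dk *; apply: vj; apply: leq_trans dk; apply: leq_sub2l.
  rewrite ltnS leq_eqVlt => /orP[/eqP ->|kj] kL dk; first exact: vj.
  by rewrite v2 (ltn_eqF kj) d1.
- by move=> s1 ag1 [_ d1]; apply: HQ ag1 _ => k kL; apply: d1.
Qed.

Lemma run_solve s (Q : state R -> Prop) :
  Env s -> Alive A s ->
  (forall s', agree (nmods Solve) (rmods Solve) s s' ->
     rmem s' res 0 = value r ([ffun=> ord0] : col) -> Q s') ->
  run B Solve s Q.
Proof.
move=> Es As HQ; apply/run_frame; rewrite /Solve.
apply/run_then => //.
apply: (run_generate Es As) => s1 L ag1 R1 NL.
have Es1 : Env s1 by exact: env_agree ag1 _ _ Es.
have LB : size L <= B.
  by apply: card_B => [|x]; [case: NL | case: NL => _ -> /andP[]].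
have [[_ _ Em1 _] _ _ _ _] := Es1.
apply/run_then => //; apply: (run_for_ord (J := m) (I := fun i s' =>
  correct_from L (m - i) s')) => //.
- move=> k _; rewrite subn0 leqNgt.
  by have := depth_lt r treeT (at_ L k).1; rewrite card_ord => ->.
- move=> i s2 Ei ag2 c2.
  have Es2 : Env s2 by exact: env_agree ag2 _ _ Es1.
  have Rs2 : Records L s2 by exact: records_agree ag2 _ R1.
  exact: (run_round Es2 Rs2 NL (ltn_ord i) c2).
move=> s2 ag2 c2.
have Es2 : Env s2 by exact: env_agree ag2 _ _ Es1.
have Rs2 : Records L s2 by exact: records_agree ag2 _ R1.
have {}c2 k : k < size L -> rmem s2 vals k = value (at_ L k).1 (at_ L k).2.
  by move=> kL; rewrite c2 // subnn.
apply: (run_for_ord (J := size L) (I := fun j s' => forall k, k < j ->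
  k < size L -> (at_ L k).1 = r -> rmem s' res 0 = value r ([ffun=> ord0] : col))) => //.
- by case: Rs2.
- move=> j s3 Ej ag3 H3.
  have Es3 : Env s3 by exact: env_agree ag3 _ _ Es2.
  have [_ Cs3] : Records L s3 by exact: records_agree ag3 _ Rs2.
  have [Hn _] := Cs3 j (ltn_ord j).
  have [[_ _ _ Er3] _ _ _ _] := Es3.
  apply: (run_if B_gt0); rewrite /= Ej Hn Er3 -eqn_leq => H.
    apply: run_rset => k _ _ _; rewrite /= upd_same Ej (proj2 ag3) // c2 //.
    have rj : (at_ L j).1 = r by apply/eqP; rewrite -val_eqE.
    (* The bag of the root is empty, so its only record is the empty colouring. *)
    suff -> : (at_ L j).2 = ([ffun=> ord0] : col) by rewrite rj.
    have : at_ L j \in L by rewrite mem_nth.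
    by rewrite (proj2 NL) => /andP[+ _]; rewrite rj => /(valid_bag0 Xr).
  apply: run_skip => k; rewrite ltnS leq_eqVlt => /orP[/eqP ->|kj] kL rk.
    by rewrite rk eqxx in H.
  exact: H3 kj kL rk.
- move=> s3 ag3 H3 ag; apply: HQ ag _.
  have rL : (r, [ffun=> ord0] : col) \in L by rewrite (proj2 NL) /= valid0 ltn_ord.
  apply: (H3 (index (r, [ffun=> ord0] : col) L)); rewrite ?index_mem //.
  by rewrite /at_ nth_index.
Qed.

End Correctness.

(** * Extracting an optimal set by greedy deletion *)

Section MainLoop.
Variables (R : realType) (n d m : nat) (e : rel 'I_n) (w : 'I_n -> R).
Variables (T : rel 'I_m) (r : 'I_m) (X : 'I_m -> {set 'I_n}).
Variable (B : nat).
Hypotheses (B_gt0 : 0 < B) (nB : n <= B) (dB : d <= B) (mB : m <= B).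
Hypotheses (d_gt0 : 0 < d) (simple_e : simple_graph e).
Hypotheses (decX : tree_decomposition e T X) (Xr : X r = set0).
Local Notation col := {ffun 'I_n -> 'I_d.+1}.
Hypothesis card_B : forall A (L : seq ('I_m * col)), uniq L ->
  (forall x, x \in L -> valid e X A x.1 x.2) -> size L <= B.
Implicit Types (s : state R) (A : {set 'I_n}).
Local Notation Env := (Env d e w T r X).

Let treeT : is_tree T. Proof. by case: decX. Qed.

Definition optimum A : R := value e w r X A treeT r ([ffun=> ord0] : col).

Lemma optimum_sub A A' : A \subset A' -> (optimum A <= optimum A')%R.
Proof.
move=> AA'; have [S [SA cS wS]] := value_attained w A treeT Xr d_gt0 decX.
rewrite {1}/optimum -wS.
by apply: value_ub cS _ => //; exact: subset_trans SA AA'.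
Qed.

(* No optimal solution can leave out a vertex of [A]. *)
Lemma critical_optimal A : optimum A = optimum setT ->
  (forall v, v \in A -> (optimum (A :\ v) < optimum A)%R) ->
  max_weight_colorable d e w A.
Proof.
move=> optA crit.
have [S [SA cS wS]] := value_attained w A treeT Xr d_gt0 decX.
have SE : S = A.
  apply/eqP; rewrite eqEsubset SA; apply/subsetP => v vA.
  apply: contraLR (crit v vA) => vS; rewrite -leNgt /optimum -wS.
  by apply: value_ub cS _ => //; rewrite subsetD1 SA vS.
rewrite -SE; split=> // S' cS'; rewrite wS -/(optimum A) optA.
by apply: value_ub cS' _ => //; exact: subsetT.
Qed.

Lemma run_main s (Q : state R -> Prop) :
  Env s -> (forall s', max_weight_colorable d e w (output n s') -> Q s') ->
  run B Main s Q.
Proof.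
move=> Es HQ; have [[En _ _ _] _ _ _ _] := Es; rewrite /Main.
apply/run_then => //; apply: (run_for_ord B_gt0 (J := n) (I := fun i s' =>
  forall v : 'I_n, v < i -> nmem s' out v = 1)) => //.
  move=> v s1 Ev _ H; apply: run_nset => u; rewrite /= /upd /= Ev.
  by rewrite ltnS leq_eqVlt; case: eqP => //= _ /H.
move=> s1 ag1 H1.
have Es1 : Env s1 by exact: env_agree ag1 _ _ Es.
have As1 : Alive [set: 'I_n] s1 by move=> v; rewrite H1 // inE.
apply/run_then => //.
apply: (run_solve B_gt0 nB dB mB simple_e (card_B (A := setT)) Xr Es1 As1).
move=> s2 ag2 res2.
apply/(run_then B_gt0)/run_rset; rewrite /= res2 -/(optimum setT).
set s3 := rset _ _ _ _.
have Es2 : Env s2 by exact: env_agree ag2 _ _ Es1.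
have Es3 : Env s3 by exact: Es2.
have [[En3 _ _ _] _ _ _ _] := Es3.
apply: (run_for_ord B_gt0 (J := n) (I := fun i s' => exists A,
  [/\ Alive A s', rmem s' opt 0 = optimum setT, optimum A = optimum setT &
   forall v : 'I_n, v < i -> v \in A -> (optimum (A :\ v) < optimum A)%R])) => //.
- exists setT; split=> //; exact: (alive_agree ag2 _ As1).
- move=> v s4 Ev ag4 [A [As4 opt4 optA crit]].
  have Es4 : Env s4 by exact: env_agree ag4 _ _ Es3.
  apply/(run_then B_gt0)/run_nset; rewrite /= Ev; set s5 := nset _ _ _ _.
  have As5 : Alive (A :\ v) s5.
    move=> u; rewrite /= /upd /= !inE As4 -val_eqE /=.
    by case: eqP.
  have Es5 : Env s5 by exact: Es4.
  apply/run_then => //.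
  apply: (run_solve B_gt0 nB dB mB simple_e (card_B (A := A :\ v)) Xr Es5 As5).
  move=> s6 ag6 res6.
  have As6 : Alive (A :\ v) s6 by exact: alive_agree ag6 _ As5.
  have opt6 : rmem s6 opt 0 = optimum setT by rewrite (proj2 ag6).
  have Ev6 : nmem s6 xy 0 = v by rewrite (proj1 ag6).
  have mono u : (optimum (A :\ u) <= optimum A)%R.
    by apply: optimum_sub; exact: subsetDl.
  apply: (run_if B_gt0); rewrite /= res6 opt6 -/(optimum _) => H; rewrite -optA in H.
    apply: run_skip; exists (A :\ v).
    have optAv : optimum (A :\ v) = optimum A.
      by apply/eqP; rewrite eq_le mono H.
    split=> //; first by rewrite optAv.
    move=> u; rewrite ltnS leq_eqVlt !inE => /orP[/eqP/val_inj ->|uv].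
      by rewrite eqxx.
    (* The deletion of [v] keeps the optimum of the whole set and can only lower the one without
       [u], so [u] remains critical. *)
    move=> /andP[_ uA]; rewrite optAv; apply: le_lt_trans (crit u uv uA).
    by apply: optimum_sub; apply: setSD; exact: subsetDl.
  apply: run_nset; rewrite /= Ev6; exists A; rewrite -ltNge in H.
  (* Deleting an absent vertex cannot lower the optimum, so [v] was alive and resetting its mark to
     [1] restores [A]. *)
  have [vA|vA] := boolP (v \in A); last first.
    have E : A :\ v = A by apply/setDidPl; rewrite disjoint_sym disjoints1.
    by rewrite E ltxx in H.
  split=> // [u|u].
    rewrite /= /upd /=; case: eqP => [/val_inj ->|uv]; first by rewrite vA.
    by rewrite As6 !inE; case: eqP => // Eu; rewrite Eu in uv.
  by rewrite ltnS leq_eqVlt => /orP[/eqP/val_inj ->|]; [move=> _ | exact: crit].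
- move=> s4 ag4 [A [As4 _ optA crit]]; apply: HQ.
  have -> : output n s4 = A.
    by apply/setP => v; rewrite inE As4; case: (v \in A).
  by apply: critical_optimal => // v; apply: crit.
Qed.

End MainLoop.

Lemma nth_flatten_mx p q (M : 'I_p -> 'I_q -> bool) (i : 'I_p) (j : 'I_q) :
  nth 0 (flatten_mx M) (i * q + j) = M i j.
Proof.
have gen (xs : seq 'I_p) k : k < size xs ->
    nth 0 [seq nat_of_bool (M i' j') | i' <- xs, j' <- enum 'I_q] (k * q + j) =
    M (nth i xs k) j.
  elim: xs k => [|x xs IH] [|k] //= kx.
    rewrite mul0n add0n nth_cat size_map size_enum_ord ltn_ord.
    by rewrite (nth_map j) ?size_enum_ord ?nth_ord_enum.
  rewrite nth_cat size_map size_enum_ord mulSn -addnA ltnNge leq_addr /=.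
  by rewrite addKn IH.
by rewrite gen ?size_enum_ord // nth_ord_enum.
Qed.

Lemma env_input (R : realType) n d m (e : rel 'I_n) (w : 'I_n -> R)
    (T : rel 'I_m) (r : 'I_m) (X : 'I_m -> {set 'I_n}) :
  Env d e w T r X (input d e w T r X).
Proof.
split=> [|u v|t u|t v|v] //=; rewrite ?nth_flatten_mx //.
by rewrite (nth_map v) ?size_enum_ord // nth_ord_enum.
Qed.

Lemma size_records n d m k q (e : rel 'I_n) (X : 'I_m -> {set 'I_n})
    (A : {set 'I_n}) (L : seq ('I_m * {ffun 'I_n -> 'I_d.+1})) :
  almost_chordal k e X -> k < q * q -> uniq L ->
  (forall x, x \in L -> valid e X A x.1 x.2) ->
  size L <= m * (n.+1 * 4 ^ q) ^ d.
Proof.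
move=> chX kq UL vL; rewrite -(card_uniqP UL).
apply: (@leq_trans #|[set x : 'I_m * {ffun 'I_n -> 'I_d.+1} | valid e X A x.1 x.2]|).
  by apply/subset_leq_card/subsetP => x /vL; rewrite inE.
rewrite -sum1_card (eq_bigl (fun x => valid e X A x.1 x.2)); last first.
  by move=> x; rewrite inE.
rewrite -(pair_big_dep xpredT (fun t f => valid e X A t f) (fun _ _ => 1)) /=.
rewrite -[m in m * _]card_ord -sum_nat_const leq_sum // => t _.
have := card_valid d A (chX t) kq; rewrite card_ord; apply: leq_trans.
by rewrite -sum1_card leq_eqVlt; apply/orP/or_introl/eqP/eq_bigl => f; rewrite inE.
Qed.

Theorem theorem3p6 (R : realType) :
  exists P : cmd, forall c : nat, exists C : nat,
  forall (n d k m : nat) (e : rel 'I_n) (w : 'I_n -> R)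
    (T : rel 'I_m) (r : 'I_m) (X : 'I_m -> {set 'I_n}),
  1 <= d ->
  simple_graph e ->
  tree_decomposition e T X ->
  almost_chordal k e X ->
  nice T r X ->
  m <= maxn 2 n ^ c ->
  exists (t : nat) (s : state R),
    [/\ exec P (input d e w T r X) t s,
        (t%:R <= time_bound R C n d k)%R &
        max_weight_colorable d e w (output n s)].
Proof.
(* The program is the same for all [c]; the exponent of the number of bags enters through [C]
   alone. *)
exists Main => c; exists (size_cmd Main + (c + 4) * loop_depth Main).
move=> n d k m e w T r X d_gt0 simple_e decX chX [Xr _] mn.
have [q /andP[qk kq]] := sqrt_floor k.
have card_B A (L : seq ('I_m * {ffun 'I_n -> 'I_d.+1})) : uniq L ->
    (forall x, x \in L -> valid e X A x.1 x.2) -> size L <= budget c n d q.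
  move=> UL vL; apply: leq_trans (size_records chX kq UL vL) _.
  exact: budget_records.
have [t [s [E tB optS]]] := run_main (budget_gt0 c n d q) (budget_n c n q d_gt0)
  (budget_d c n d q) (budget_m d q mn) d_gt0 simple_e decX Xr card_B
  (env_input d e w T r X) (fun s' H => H).
exists t, s; split=> //; exact: (budget_time d_gt0 R qk tB (leqnn _)).
Qed.
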